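(* Let $A$ be a minimal Auslander-Gorenstein Artin algebra with Jacobson radical $J$, and set $A_0=A/J$. Then $$\operatorname{inj\,dim}_A\Omega^n(A_0)=\operatorname{gl\,dim}A$$ for all $n\ge 0$ such that $\Omega^n(A_0)\neq 0$.
   Context: An Artin algebra is an algebra $A$ over a commutative artinian ring $R$ (with the image of $R$ central) that is finitely generated as an $R$-module. Modules are left modules. For a finitely generated $A$-module $M$, $\Omega^n(M)$ denotes the $n$-th syzygy in its minimal projective resolution, with $\Omega^0(M)=M$. The dominant dimension of a finitely generated $A$-module $M$ with minimal injective coresolution $0\to M\to I^0\to I^1\to\cdots$ is $\operatorname{dom\,dim}_A M=\inf\{n\ge 0\mid I^n\text{ is not projective}\}$ (with $\inf\emptyset=\infty$), and $\operatorname{dom\,dim}A$ is the dominant dimension of the regular module $A$. The algebra $A$ is Gorenstein (Iwanaga-Gorenstein) if $\operatorname{inj\,dim}_A A$ and $\operatorname{inj\,dim}_{A^{\mathrm{op}}}A$ are both finite; they are then equal, with common value $\operatorname{inj\,dim}A$. The algebra $A$ is minimal Auslander-Gorenstein if it is Gorenstein and $\operatorname{inj\,dim}A\le\operatorname{dom\,dim}A$. *)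

(* Defs.v *)
From HB Require Import structures.
From mathcomp Require Import all_boot all_order all_algebra.
From mathcomp Require Import boolp.

Set Implicit Arguments.
Unset Strict Implicit.
Unset Printing Implicit Defensive.

Import GRing.Theory.
Local Open Scope ring_scope.

(* Excluded middle is available (boolp), so the boolean predicates {pred V}
   used below for submodules and ideals range over all subsets of V.
   A right A-module is a left module over the converse ring A^c.             *)

(* Natural numbers extended with oo = None. *)
Definition enat := option nat.

Definition ele (a b : enat) : Prop :=
  match a, b with
  | _, None => True
  | None, Some _ => False
  | Some m, Some n => (m <= n)%N
  end.

Definition einf (P : nat -> Prop) : enat :=
  match pselect (exists n, `[< P n >]) with
  | left exP => Some (ex_minn exP)
  | right _ => None
  end.

Definition kerp (A : pzRingType) (U V : lmodType A) (f : {linear U -> V}) :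
  {pred U} := [pred x | f x == 0].

Lemma kerp_submod (A : pzRingType) (U V : lmodType A) (f : {linear U -> V}) :
  submod_closed (kerp f).
Proof.
split=> [|a x y]; rewrite !inE ?linear0 //.
by move=> /eqP fx /eqP fy; rewrite linearP fx fy scaler0 addr0.
Qed.

HB.instance Definition _ (A : pzRingType) (U V : lmodType A)
    (f : {linear U -> V}) :=
  GRing.isSubmodClosed.Build A U (kerp f) (kerp_submod f).

Record ker (A : pzRingType) (U V : lmodType A) (f : {linear U -> V}) :=
  Ker { ker_val :> U; _ : ker_val \in kerp f }.

HB.instance Definition _ (A : pzRingType) (U V : lmodType A)
  (f : {linear U -> V}) := [isSub for @ker_val A U V f].
HB.instance Definition _ (A : pzRingType) (U V : lmodType A)
  (f : {linear U -> V}) := [Choice of ker f by <:].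
HB.instance Definition _ (A : pzRingType) (U V : lmodType A)
  (f : {linear U -> V}) := [SubChoice_isSubLmodule of ker f by <:].

Definition surjective_fun (U V : Type) (f : U -> V) : Prop :=
  forall v, exists u, f u = v.

Definition projective (A : pzRingType) (P : lmodType A) : Prop :=
  forall (U V : lmodType A) (g : {linear U -> V}) (f : {linear P -> V}),
    surjective_fun g -> exists h : {linear P -> U}, forall x, g (h x) = f x.

Definition injective_module (A : pzRingType) (I : lmodType A) : Prop :=
  forall (U V : lmodType A) (g : {linear U -> V}) (f : {linear U -> I}),
    injective g -> exists h : {linear V -> I}, forall x, h (g x) = f x.

(* ker f is superfluous: ker f + S = U implies S = U *)
Definition superfluous_ker (A : pzRingType) (U V : lmodType A)
    (f : {linear U -> V}) : Prop :=
  forall S : {pred U}, submod_closed S ->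
    (forall u, exists2 k, f k = 0 & u - k \in S) -> forall u, u \in S.

(* im f is essential: im f meets S trivially only if S = 0 *)
Definition essential_im (A : pzRingType) (U V : lmodType A)
    (f : {linear U -> V}) : Prop :=
  forall S : {pred V}, submod_closed S ->
    (forall u, f u \in S -> f u = 0) -> forall v, v \in S -> v = 0.

(* ... -> P 2 -> P 1 -> P 0 -> M -> 0 *)
Record proj_resolution (A : pzRingType) (M : lmodType A) := ProjResolution {
  pr_obj : nat -> lmodType A;
  pr_d : forall n, {linear pr_obj n.+1 -> pr_obj n};
  pr_aug : {linear pr_obj 0%N -> M};
  pr_projective : forall n, projective (pr_obj n);
  pr_aug_surj : surjective_fun pr_aug;
  pr_exact0 : forall x, pr_aug x = 0 <-> exists y, pr_d 0 y = x;
  pr_exactS : forall n x, pr_d n x = 0 <-> exists y, pr_d n.+1 y = x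
}.

(* 0 -> M -> I 0 -> I 1 -> I 2 -> ... *)
Record inj_coresolution (A : pzRingType) (M : lmodType A) := InjCoresolution {
  ic_obj : nat -> lmodType A;
  ic_d : forall n, {linear ic_obj n -> ic_obj n.+1};
  ic_aug : {linear M -> ic_obj 0%N};
  ic_injective : forall n, injective_module (ic_obj n);
  ic_aug_inj : injective ic_aug;
  ic_exact0 : forall x, ic_d 0 x = 0 <-> exists y, ic_aug y = x;
  ic_exactS : forall n x, ic_d n.+1 x = 0 <-> exists y, ic_d n y = x
}.

(* every P n is a projective cover of the corresponding syzygy *)
Definition minimal_pr (A : pzRingType) (M : lmodType A)
    (P : proj_resolution M) : Prop :=
  superfluous_ker (pr_aug P) /\ forall n, superfluous_ker (pr_d P n).

(* every I n is an injective envelope of the corresponding cosyzygy *)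
Definition minimal_ic (A : pzRingType) (M : lmodType A)
    (I : inj_coresolution M) : Prop :=
  essential_im (ic_aug I) /\ forall n, essential_im (ic_d I n).

(* The n-th syzygy of M computed from P; it is Omega^n(M) when P is minimal. *)
Definition syzygy (A : pzRingType) (M : lmodType A) (P : proj_resolution M)
    (n : nat) : lmodType A :=
  match n with
  | 0 => M
  | 1 => ker (pr_aug P)
  | m.+2 => ker (pr_d P m)
  end.

Definition zero_module (A : pzRingType) (M : lmodType A) : Prop :=
  forall x : M, x = 0.

Definition proj_dim (A : pzRingType) (M : lmodType A) : enat :=
  einf (fun n => exists P : proj_resolution M,
    forall i, (n < i)%N -> zero_module (pr_obj P i)).

Definition inj_dim (A : pzRingType) (M : lmodType A) : enat :=
  einf (fun n => exists I : inj_coresolution M,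
    forall i, (n < i)%N -> zero_module (ic_obj I i)).

(* the supremum of the projective dimensions, i.e. their least upper bound *)
Definition gl_dim (A : pzRingType) : enat :=
  einf (fun n => forall M : lmodType A, ele (proj_dim M) (Some n)).

(* Minimal injective coresolutions are unique up to isomorphism, so the
   choice of I is immaterial. *)
Definition dom_dim (A : pzRingType) (M : lmodType A) : enat :=
  einf (fun n => exists I : inj_coresolution M,
    minimal_ic I /\ ~ projective (ic_obj I n)).

Definition gorenstein (A : pzRingType) : Prop :=
  inj_dim A^o <> None /\ inj_dim (A^c)^o <> None.

Definition minimal_auslander_gorenstein (A : pzRingType) : Prop :=
  gorenstein A /\ ele (inj_dim A^o) (dom_dim A^o).

Definition maximal_left_ideal (A : pzRingType) (I : {pred A^o}) : Prop :=
  [/\ submod_closed I, 1 \notin I &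
      forall K : {pred A^o}, submod_closed K -> {subset I <= K} ->
        1 \notin K -> {subset K <= I}].

Definition in_jacobson_radical (A : pzRingType) (a : A) : Prop :=
  forall I : {pred A^o}, maximal_left_ideal I -> a \in I.

(* M is A / J up to isomorphism: a quotient of A with kernel J *)
Definition radical_quotient (A : pzRingType) (M : lmodType A) : Prop :=
  exists p : {linear A^o -> M},
    surjective_fun p /\ forall a, p a = 0 <-> in_jacobson_radical a.

Definition artinian (R : comPzRingType) : Prop :=
  forall I : nat -> {pred R^o},
    (forall n, submod_closed (I n)) ->
    (forall n, {subset I n.+1 <= I n}) ->
    exists n, forall m, (n <= m)%N -> I m =i I n.

Definition finitely_generated (R : pzRingType) (M : lmodType R) : Prop :=
  exists (n : nat) (s : 'I_n -> M),
    forall x, exists c : 'I_n -> R, x = \sum_(i < n) c i *: s i.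

Definition artin_algebra (R : comPzRingType) (A : algType R) : Prop :=
  artinian R /\ finitely_generated A.

(* Main.v *)
(* Write d = gl.dim A and E(k, M) for the vanishing of Ext^k(A/J, M); over an
   artinian ring E(k+1, M) means inj.dim M <= k. If inj.dim Omega^n(A/J) is
   finite, dimension shifting along the minimal projective resolution P, whose
   terms have finite injective dimension because A has, shows that
   inj.dim A/J is finite; each simple module T is a summand of A/J, so
   Ext^k(A/J, T) = Hom(P_k, T) vanishes for large k and P stops: d is finite.
   When d is finite, some simple T has Ext^d(A/J, T) <> 0, hence
   Ext^n(A/J, T) <> 0 for all n <= d, so T is a quotient of Omega^n(A/J). As
   Ext^(d+1) vanishes, Ext^d(A/J, Omega^n(A/J)) maps onto Ext^d(A/J, T), which
   gives inj.dim Omega^n(A/J) = d. *)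

Require Import Defs.
From HB Require Import structures.
From mathcomp Require Import all_boot all_order all_algebra.
From mathcomp Require Import boolp classical_sets functions fsbigop.

Set Implicit Arguments.
Unset Strict Implicit.
Unset Printing Implicit Defensive.

Import GRing.Theory Num.Theory.
Local Open Scope classical_set_scope.
Local Open Scope ring_scope.

(** * Submodules, quotients and Baer's criterion *)

(** [gl_dim A] bounds arbitrary modules, and the terms of [P] are treated without finite generation,
    so two facts are needed for all modules. One is that Ext from A/J detects injectivity: over a
    left artinian ring every nonzero module contains a simple one, so Baer's criterion needs only
    maximal left ideals m, and each m has an element e, idempotent modulo J, with 1 - e in m and m e
    inside J; extending a map from m thus reduces to extending one from J. The other is that every
    projective has finite injective dimension once A has: it is a summand of a direct sum of copies
    of A, and direct sums of injectives are injective because J is finitely generated. Both rest on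
    the descending chain condition for left ideals, which passes from R to A. Ext groups are never
    formed: vanishing means that cocycles on a fixed resolution are coboundaries, and the pieces of
    the long exact sequence are chased on such maps. *)

Definition submodule (A : pzRingType) (V : lmodType A) (S : set V) : Prop :=
  S 0 /\ forall a x y, S x -> S y -> S (a *: x + y).

Section Submodule.
Variables (A : pzRingType) (V : lmodType A) (S : set V).
Hypothesis subS : submodule S.

Lemma submodule0 : S 0. Proof. by case: subS. Qed.

Lemma submoduleD x y : S x -> S y -> S (x + y).
Proof. by case: subS => _ SP Sx Sy; rewrite -[x]scale1r; apply: SP. Qed.

Lemma submoduleZ a x : S x -> S (a *: x).
Proof. by case: subS => S0 SP Sx; rewrite -[_ *: _]addr0; apply: SP. Qed.

Lemma submoduleN x : S x -> S (- x).
Proof. by move=> Sx; rewrite -scaleN1r; apply: submoduleZ. Qed.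

Lemma submoduleB x y : S x -> S y -> S (x - y).
Proof. by move=> Sx Sy; apply: submoduleD => //; apply: submoduleN. Qed.

Lemma submodule_pred : submod_closed [pred x | `[< S x >]].
Proof.
split=> [|a x y]; first by apply/asboolP; case: subS.
by move=> /asboolP Sx /asboolP Sy; apply/asboolP; apply: subS.2.
Qed.

End Submodule.

Lemma pred_submodule (A : pzRingType) (V : lmodType A) (S : {pred V}) :
  submod_closed S -> submodule [set x | x \in S].
Proof. by case=> S0 SP; split=> // a x y; apply: SP. Qed.

Section LinearMaps.
Variable A : pzRingType.
Implicit Types U V W : lmodType A.

Lemma submodule_preim U V (f : {linear U -> V}) (S : set V) :
  submodule S -> submodule [set u | S (f u)].
Proof.
move=> sS; split=> [|a x y Sx Sy] /=; first by rewrite linear0; case: sS.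
by rewrite linearP; apply: sS.2.
Qed.

Lemma submodule0set V : submodule [set x : V | x = 0].
Proof. by split=> // a x y /= -> ->; rewrite scaler0 addr0. Qed.

Lemma submoduleT V : submodule [set: V].
Proof. by []. Qed.

Lemma submodule_ker U V (f : {linear U -> V}) : submodule [set u | f u = 0].
Proof. exact: submodule_preim (submodule0set _). Qed.

Lemma submodule_im U V (f : {linear U -> V}) (S : set U) :
  submodule S -> submodule (f @` S).
Proof.
move=> sS; split=> [|a _ _ [x Sx <-] [y Sy <-]].
  by exists 0; [case: sS | rewrite linear0].
by exists (a *: x + y); [apply: sS.2 | rewrite linearP].
Qed.

Lemma linear_exists U V (h : U -> V) :
  linear h -> exists h' : {linear U -> V}, h' =1 h.
Proof.
move=> hL; pose i := GRing.isLinear.Build A U V *:%R h hL.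
by exists (HB.pack_for {linear U -> V} h i).
Qed.

Lemma graph_linear U V (G : set (U * V)) :
    submodule G -> (forall v, G (0, v) -> v = 0) ->
    (forall u, exists v, G (u, v)) ->
  exists h : {linear U -> V}, forall u, G (u, h u).
Proof.
move=> sG funG /choice[h Gh].
suff /linear_exists[h' h'E] : linear h by exists h' => u; rewrite h'E.
move=> a u v; apply/eqP; rewrite -subr_eq0; apply/eqP/funG.
have := submoduleB sG (Gh (a *: u + v)) (sG.2 a _ _ (Gh u) (Gh v)).
by congr G; congr pair; rewrite /= subrr.
Qed.

Lemma factor_surj U V W (d : {linear U -> V}) (f : {linear U -> W}) :
    surjective_fun d -> (forall u, d u = 0 -> f u = 0) ->
  exists h : {linear V -> W}, forall u, h (d u) = f u.
Proof.
move=> dS kf; pose G : set (V * W) := [set vw | exists u, vw = (d u, f u)].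
have sG : submodule G.
  split; first by exists 0; rewrite !linear0.
  by move=> a _ _ [u ->] [v ->]; exists (a *: u + v); rewrite !linearP.
have fG w : G (0, w) -> w = 0 by case=> u [/esym/kf fu0 ->].
have [|h Gh] := graph_linear sG fG.
  by move=> v; have [u <-] := dS v; exists (f u), u.
exists h => u; have [u' [du hu]] := Gh (d u).
by apply/eqP; rewrite hu -subr_eq0 -linearB; apply/eqP/kf; rewrite linearB du subrr.
Qed.

Lemma factor_inj U V W (i : {linear U -> V}) (f : {linear W -> V}) :
    injective i -> (forall w, exists u, i u = f w) ->
  exists h : {linear W -> U}, forall w, i (h w) = f w.
Proof.
move=> iI /choice[h hE]; have hL : linear h.
  by move=> a x y; apply: iI; rewrite linearP !hE linearP.
by have [h' h'E] := linear_exists hL; exists h' => w; rewrite h'E.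
Qed.

Lemma linear_injP U V (f : {linear U -> V}) :
  (forall u, f u = 0 -> u = 0) -> injective f.
Proof.
move=> f0 x y fxy; apply/eqP; rewrite -subr_eq0; apply/eqP/f0.
by rewrite linearB fxy subrr.
Qed.

End LinearMaps.

Section Quotient.
Variables (A : pzRingType) (V : lmodType A) (S : set V).

(** Congruent elements hand the same set to [xget], so the chosen representative depends on the
    coset alone and the quotient can be the subtype of its fixed points. *)
Definition coset_rep (x : V) : V := xget 0 [set y | S (y - x)].

Hypothesis subS : submodule S.

Lemma coset_repP x : S (coset_rep x - x).
Proof.
suff: [set y | S (y - x)] x by move=> /(xgetI 0).
by rewrite /= subrr; case: subS.
Qed.

Lemma coset_rep_eq x y : S (x - y) -> coset_rep x = coset_rep y.
Proof.
move=> Sxy; rewrite /coset_rep; congr xget; apply/seteqP; split=> z /= Sz.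
  by rewrite -[z - y](subrKA x); apply: submoduleD.
rewrite -[z - x](subrKA y); apply: submoduleD => //.
by rewrite -opprB; apply: submoduleN.
Qed.

(** The proof [subS'] is a parameter of the type so that the module structure, which depends on it,
    can be inferred. *)
Record quotient (subS' : submodule S) : Type :=
  Quotient { quotient_val : V; _ : coset_rep quotient_val == quotient_val }.

End Quotient.

Section QuotientModule.
Variables (A : pzRingType) (V : lmodType A) (S : set V) (subS : submodule S).
Local Notation Q := (quotient subS).
Local Notation rep := (coset_rep S).

HB.instance Definition _ := [isSub for @quotient_val A V S subS].
HB.instance Definition _ := [Choice of Q by <:].

Lemma coset_rep_id x : rep (rep x) == rep x.
Proof. by apply/eqP/(coset_rep_eq subS)/(coset_repP subS). Qed.

Definition quotient_map (x : V) : Q := Quotient subS (coset_rep_id x).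

Lemma quotient_mapP x y : quotient_map x = quotient_map y <-> S (x - y).
Proof.
split=> [/(congr1 val)/= rxy|Sxy]; last by apply/val_inj/coset_rep_eq.
rewrite -[x - y](subrKA (rep x)); apply: (submoduleD subS).
  by rewrite -opprB; apply/(submoduleN subS)/(coset_repP subS).
by rewrite rxy; apply: coset_repP subS _.
Qed.

Lemma quotient_valK : cancel val quotient_map.
Proof. by case=> x xE; apply/val_inj/eqP. Qed.

Let add (x y : Q) := quotient_map (val x + val y).
Let opp (x : Q) := quotient_map (- val x).
Let scale a (x : Q) := quotient_map (a *: val x).

Let map_add x y : quotient_map (x + y) = add (quotient_map x) (quotient_map y).
Proof.
apply/quotient_mapP; rewrite opprD addrACA; apply: (submoduleD subS) => /=;
  by rewrite -opprB; apply/(submoduleN subS)/(coset_repP subS).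
Qed.

Let map_scale a x : quotient_map (a *: x) = scale a (quotient_map x).
Proof.
apply/quotient_mapP; rewrite -scalerBr; apply: (submoduleZ subS) => /=.
by rewrite -opprB; apply/(submoduleN subS)/(coset_repP subS).
Qed.

Let map_opp x : quotient_map (- x) = opp (quotient_map x).
Proof. by rewrite -scaleN1r map_scale /scale scaleN1r. Qed.

Let addA : associative add.
Proof.
move=> x y z; rewrite -[x]quotient_valK -[y]quotient_valK -[z]quotient_valK.
by rewrite -!map_add addrA.
Qed.
Let addC : commutative add.
Proof. by move=> x y; rewrite /add addrC. Qed.
Let add0 : left_id (quotient_map 0) add.
Proof. by move=> x; rewrite -[x]quotient_valK -map_add add0r. Qed.
Let addN : left_inverse (quotient_map 0) opp add.
Proof. by move=> x; rewrite -[x]quotient_valK -map_opp -map_add addNr. Qed.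

HB.instance Definition _ := GRing.isZmodule.Build Q addA addC add0 addN.

Let scaleA a b v : scale a (scale b v) = scale (a * b) v.
Proof. by rewrite -[v]quotient_valK -!map_scale scalerA. Qed.
Let scale1 : left_id 1 scale.
Proof. by move=> v; rewrite -[v]quotient_valK -map_scale scale1r. Qed.
Let scaleDr : right_distributive scale +%R.
Proof.
move=> a u v; rewrite -[u]quotient_valK -[v]quotient_valK.
by rewrite -[_ + _]map_add -!map_scale -[RHS]map_add scalerDr.
Qed.
Let scaleDl v : {morph scale^~ v: a b / a + b}.
Proof.
move=> a b; rewrite -[v]quotient_valK -!map_scale.
by rewrite -[RHS]map_add scalerDl.
Qed.

HB.instance Definition _ :=
  GRing.Zmodule_isLmodule.Build A Q scaleA scale1 scaleDr scaleDl.

Let map_linear : linear quotient_map.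
Proof. by move=> a x y; rewrite map_add map_scale. Qed.

HB.instance Definition _ := GRing.isLinear.Build A V Q _ quotient_map map_linear.

End QuotientModule.

Lemma quotient_exists (A : pzRingType) (V : lmodType A) (S : set V) :
    submodule S ->
  exists (Q : lmodType A) (p : {linear V -> Q}),
    surjective_fun p /\ forall v, p v = 0 <-> S v.
Proof.
move=> sS; exists (quotient sS), (quotient_map sS); split=> [q|v].
  by exists (val q); apply: quotient_valK.
rewrite -(linear0 (quotient_map sS)) -[X in S X]subr0; exact: quotient_mapP.
Qed.

Section Zorn.
Variables (A : pzRingType) (V : lmodType A) (S B : set V).

(** Zorn's lemma with a forbidden set [B]: nonzero values over 0 when graphs are extended, a chosen
    element and the complement of a submodule when simple quotients are built. *)
Lemma max_submodule :
    submodule S -> (forall x, S x -> ~ B x) ->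
  exists M : set V, [/\ submodule M, S `<=` M, (forall x, M x -> ~ B x) &
    forall M' : set V, submodule M' -> M `<=` M' ->
      (forall x, M' x -> ~ B x) -> M' `<=` M].
Proof.
move=> sS SB.
(* Adjoining [S] makes the empty chain harmless: its union is empty, hence not a submodule. *)
pose good (X : set V) := submodule (S `|` X) /\ forall x, (S `|` X) x -> ~ B x.
have [|M [[sM MB] maxM]] := @Zorn_bigcup V good.
  move=> F Fgood totF.
  pose UF := \bigcup_(X in F) X.
  have two x y : (S `|` UF) x -> (S `|` UF) y ->
      exists X, [/\ good X, (S `|` X) x, (S `|` X) y & S `|` X `<=` S `|` UF].
    have le X : F X -> S `|` X `<=` S `|` UF.
      by move=> FX z [Sz|Xz]; [left|right; exists X].
    have g0 : good set0 by rewrite /good setU0.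
    case=> [Sx|[X FX Xx]] [Sy|[Y FY Yy]].
    - by exists set0; rewrite setU0; split=> // z; left.
    - by exists Y; split; [exact: Fgood| by left| by right| exact: le].
    - by exists X; split; [exact: Fgood| by right| by left| exact: le].
    have [XY|YX] := totF _ _ FX FY.
      by exists Y; split; [exact: Fgood| right; apply: XY| by right| exact: le].
    by exists X; split; [exact: Fgood| by right|right; apply: YX| exact: le].
  split; last by move=> x Ux; have [X [[_ XB] Xx _ _]] := two x x Ux Ux; apply: XB.
  split; first by left; case: sS.
  move=> a x y Ux Uy; have [X [[sX _] Xx Xy]] := two x y Ux Uy.
  by apply; apply: sX.2.
exists (S `|` M); split=> // M' sM' MM' M'B.
apply: contrapT => nM'M; apply: (maxM M'); last first.
  by rewrite /good (_ : S `|` M' = M') //; apply/setUidPr => x Sx; apply: MM'; left.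
by split=> [x Mx|E]; [apply: MM'; right | apply: nM'M => x M'x; right; apply: E].
Qed.

End Zorn.

Section Baer.
Variables (A : pzRingType) (M : lmodType A) (C : set (set A^o)).
Hypothesis testable : forall (V : lmodType A) (N : set V), submodule N ->
  forall v, ~ N v -> exists b, ~ N (b *: v) /\ C [set a | N (a *: (b *: v))].
Hypothesis extend : forall G : set (A^o * M), submodule G ->
  (forall m, G (0, m) -> m = 0) -> C [set a | exists m, G (a, m)] ->
  exists m0 : M, forall (a : A) m, G (a, m) -> m = a *: m0.

(** Baer's argument relative to a class [C] of left ideals. If a maximal partial map misses v, some
    multiple w = b v is also missed and its ideal lies in [C]; the map a to G'(a w) is then
    multiplication by some m0, and w can be sent to m0. All ideals are allowed for the integers,
    only maximal ones over an artinian ring. *)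
Lemma baer_partial (V : lmodType A) (G : set (V * M)) :
    submodule G -> (forall m, G (0, m) -> m = 0) ->
  exists h : {linear V -> M}, forall v m, G (v, m) -> h v = m.
Proof.
move=> sG fG.
have [|G' [sG' GG' fG' maxG']] :=
    @max_submodule A (V * M)%type G [set vm | vm.1 = 0 /\ vm.2 <> 0] sG.
  by move=> [v m] Gvm [/= v0]; apply; apply: fG; rewrite -v0.
have {}fG' m : G' (0, m) -> m = 0.
  by move=> /fG' /= nm; apply: contrapT => m0; apply: nm.
have fun2 v m m' : G' (v, m) -> G' (v, m') -> m = m'.
  move=> Gm Gm'; apply/eqP; rewrite -subr_eq0; apply/eqP/fG'.
  by have := submoduleB sG' Gm Gm'; congr G'; congr pair; rewrite /= subrr.
pose N := [set v | exists m, G' (v, m)].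
have sN : submodule N.
  split; first by exists 0; exact: submodule0 sG'.
  by move=> a x y [m Gm] [m' Gm']; exists (a *: m + m'); have := sG'.2 a _ _ Gm Gm'.
suff totN v : N v.
  have [h hE] := graph_linear sG' fG' totN.
  by exists h => v m /GG'; exact: fun2.
apply: contrapT => Nv; have [b [Nbv Cb]] := testable sN Nv.
set w := b *: v in Nbv Cb.
pose H : set (A^o * M) := [set am | G' (am.1 *: w, am.2)].
have [||//|m0 m0E] := @extend H.
- split=> /=; first by rewrite /H /= scale0r; exact: submodule0 sG'.
  move=> a [x m] [y m']; rewrite /H /= => Gx Gy.
  rewrite scalerDl -scalerA.
  exact: sG'.2 a _ _ Gx Gy.
- by move=> m; rewrite /H /= scale0r; exact: fG'.
(* [K] is the sum of [G'] and the cyclic submodule generated by (w, m0). *)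
pose K : set (V * M) := [set vm | exists a, G' (vm.1 - a *: w, vm.2 - a *: m0)].
have sK : submodule K.
  split; first by exists 0; rewrite !scale0r !subr0; exact: submodule0 sG'.
  move=> a [x m] [y m'] [b1 Gx] [b2 Gy]; exists (a * b1 + b2).
  have := sG'.2 a _ _ Gx Gy; congr G'; congr pair => /=;
  by rewrite scalerBr scalerA scalerDl opprD addrACA.
have wK : K (w, m0) by exists 1; rewrite !scale1r !subrr; exact: submodule0 sG'.
apply: Nbv; exists m0; apply: (maxG' K) => //.
  by move=> [x m] Gxm; exists 0; rewrite !scale0r !subr0.
move=> [x m] [a Gxm] [/= x0]; apply.
have /m0E : H (- a, m - a *: m0).
  by move: Gxm; rewrite /H /= x0 add0r scaleNr.
by rewrite scaleNr => /(congr1 (+%R^~ (a *: m0))); rewrite subrK addNr.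
Qed.

Lemma baer_injective : injective_module M.
Proof.
move=> U V g f gI.
have [||h hE] := @baer_partial V [set vm | exists u, vm = (g u, f u)].
- split; first by exists 0; rewrite !linear0.
  by move=> a _ _ [u ->] [v ->]; exists (a *: u + v); rewrite !linearP.
- by move=> m [u [/esym/eqP + ->]]; rewrite -(linear0 g) => /eqP/gI ->; exact: linear0.
- by exists h => u; apply: hE; exists u.
Qed.

End Baer.

(** * Enough injectives *)

Lemma submodule_exists (A : pzRingType) (V : lmodType A) (S : set V) :
    submodule S ->
  exists (T : lmodType A) (i : {linear T -> V}),
    injective i /\ forall v, S v <-> exists t, i t = v.
Proof.
move=> /quotient_exists[Q [p [_ pS]]].
have [|i iE] := @linear_exists A (ker p) V val; first by [].
exists (ker p), i; split=> [x y|v]; first by rewrite !iE => /val_inj.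
split=> [/pS/eqP pv0|[t <-]].
  by exists (Sub v pv0 : ker p); rewrite iE.
by rewrite iE; apply/pS/eqP; apply: (valP t).
Qed.

Lemma product_injective (A : pzRingType) (S : Type) (I : lmodType A) :
  injective_module I -> injective_module (S -> I).
Proof.
move=> injI U V g f gI.
have fs s : exists h : {linear V -> I}, forall u, h (g u) = f u s.
  have [|fs fsE] := @linear_exists A U I (fun u => f u s).
    by move=> a x y; rewrite linearP.
  by have [h hE] := injI _ _ g fs gI; exists h => u; rewrite hE fsE.
have [h hE] := choice fs.
have [|h' h'E] := @linear_exists A V (S -> I) (fun v s => h s v).
  by move=> a x y; apply/funext => s; rewrite linearP.
by exists h' => u; apply/funext => s; rewrite h'E hE.
Qed.

Lemma int_ideal_principal (I : set int^o) :
  submodule I -> exists n : int, forall a, I a <-> exists q, a = q * n.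
Proof.
move=> sI.
have [[a [Ia a0]]|I0] := pselect (exists a, I a /\ a <> 0); last first.
  exists 0 => a; split=> [Ia|[q ->]]; last by rewrite mulr0; case: sI.
  by exists 0; rewrite mul0r; apply: contrapT => a0; apply: I0; exists a.
pose P k := `[< (0 < k)%N /\ I (Posz k) >].
have exP : exists k, P k.
  exists `|a|%N; apply/asboolP; rewrite absz_gt0; split; first exact/eqP.
  have [e ->] : exists e : int, Posz `|a| = e *: (a : int^o).
    by exists (sgz a); rewrite abszEsg.
  exact: submoduleZ.
case: (ex_minnP exP) => n /asboolP[n0 In] minn; exists n%:Z => b.
split=> [Ib|[q ->]]; last exact: (submoduleZ sI q In).
have Ir : I (b %% n)%Z.
  by rewrite /modz; apply: (submoduleB sI) => //; exact: (submoduleZ sI _ In).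
exists (b %/ n)%Z; rewrite {1}(divz_eq b n).
have : (0 <= b %% n)%Z by apply: modz_ge0; rewrite -lt0n.
have : (b %% n < n)%Z by apply: ltz_pmod.
case: (b %% n)%Z Ir => // -[|r] Ir rn _; first by rewrite addr0.
have /minn : P r.+1 by apply/asboolP.
by rewrite leqNgt -ltz_nat rn.
Qed.

Lemma int_submodule : submodule [set q : zmodule rat | q \is a Num.int].
Proof.
split=> [|a x y /= xZ yZ]; first exact: rpred0.
by rewrite rpredD // scalezrE -mulrzr rpredM // intr_int.
Qed.

(** The group Q/Z, divisible and a cogenerator of abelian groups. *)
Definition ratZ : lmodType int := quotient int_submodule.

Lemma ratZ_divisible (n : int) (d : ratZ) :
  n != 0 -> exists c : ratZ, n *: c = d.
Proof.
move=> n0; pose q : rat := val d; exists (quotient_map int_submodule (q / n%:~R)).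
rewrite -linearZ -[d]quotient_valK; congr quotient_map.
by rewrite scalezrE -mulrzr divfK // intr_eq0.
Qed.

Lemma ratZ_extend (V : lmodType int) (G : set (V * ratZ)) :
    submodule G -> (forall m, G (0, m) -> m = 0) ->
  exists h : {linear V -> ratZ}, forall v m, G (v, m) -> h v = m.
Proof.
apply: (@baer_partial _ _ setT) => [W N _ v Nv|{}G sG fG _].
  by exists 1; rewrite scale1r.
have [|n nE] := @int_ideal_principal [set a | exists m, G (a, m)].
  split; first by exists 0; exact: submodule0 sG.
  by move=> a x y [m Gm] [m' Gm']; exists (a *: m + m'); have := sG.2 a _ _ Gm Gm'.
have [|m Gnm] := (nE n).2; first by exists 1; rewrite mul1r.
(* Extending from the ideal generated by n means dividing the value at n by n; for n = 0 that value
   is 0 because [G] is functional. *)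
have [m0 m0E] : exists m0, n *: m0 = m.
  have [n0|/ratZ_divisible] := eqVneq n 0; last exact.
  by exists 0; rewrite scaler0 (fG m) // -n0.
exists m0 => a m' Gam'; have [|q aE] := (nE a).1; first by exists m'.
rewrite aE -scalerA m0E; apply/eqP; rewrite -subr_eq0; apply/eqP/fG.
have := submoduleB sG Gam' (submoduleZ sG q Gnm); congr G; congr pair => /=.
by rewrite aE subrr.
Qed.

Lemma ratZ_separates (V : lmodType int) (x : V) :
  x <> 0 -> exists h : {linear V -> ratZ}, h x <> 0.
Proof.
move=> x0; have [|n nE] := @int_ideal_principal [set a : int^o | a *: x = 0].
  split; rewrite /= ?scale0r // => a k l kx lx.
  by rewrite scalerDl -scalerA kx lx scaler0 addr0.
have n1 q : 1 <> q * n.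
  by move=> E; apply: x0; rewrite -[x]scale1r; apply/(nE 1); exists q.
(* A non-integer whose n-th multiple is an integer, n generating the annihilator of x; for x of
   infinite order, n is 0 and 1/2 serves. *)
pose c : rat := if n == 0 then 2^-1 else n%:~R^-1.
have cN : c \isn't a Num.int.
  apply/negP => /intrP[k]; rewrite /c; case: eqVneq => n0 ck.
    have : 1 = (k * 2)%:~R :> rat by rewrite intrM -ck mulVf.
    by move/eqP; rewrite -[1]/(1%:~R) eqr_int => /eqP; case: k {ck} => [] [|[|k]].
  apply: (n1 k); apply/eqP; rewrite -(eqr_int rat) intrM -ck mulVf //.
  by rewrite intr_eq0.
have cn k : k *: x = 0 -> k *: (c : zmodule rat) \is a Num.int.
  move/(nE k) => [q ->]; rewrite scalezrE -mulrzr intrM /c.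
  have [->|n0] := eqVneq; first by rewrite !mulr0 rpred0.
  by rewrite mulrCA mulVf ?intr_eq0 // mulr1 intr_int.
pose d : ratZ := quotient_map int_submodule c.
have [||h hE] := @ratZ_extend V [set vm | exists k : int, vm = (k *: x, k *: d)].
- split; first by exists 0; rewrite !scale0r.
  move=> a _ _ [k ->] [l ->]; exists (a * k + l).
  by rewrite !scalerDl -!scalerA.
- move=> m [k [/esym /cn kx ->]]; rewrite -linearZ -(linear0 (quotient_map _)).
  by apply/quotient_mapP; rewrite subr0.
exists h; rewrite (hE x d); last by exists 1; rewrite !scale1r.
rewrite -(linear0 (quotient_map _)) => /quotient_mapP; rewrite subr0 => /=.
exact/negP.
Qed.

(* The coinduced module Hom_Z(A, Q/Z): its universal property reduces
   injectivity over A to injectivity of Q/Z over the integers. *)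
Section Coinduced.
Variable A : pzRingType.

Definition additive_pred : {pred A -> ratZ} :=
  [pred f | `[< {morph f : a b / a + b} >] ].

Lemma additive_pred_closed : zmod_closed additive_pred.
Proof.
split=> [|f g /asboolP fD /asboolP gD]; apply/asboolP => a b /=.
  by rewrite addr0.
by rewrite !fctE fD gD opprD addrACA.
Qed.

HB.instance Definition _ :=
  GRing.isZmodClosed.Build (A -> ratZ) additive_pred additive_pred_closed.

Record coinduced := Coinduced { coinduced_val :> A -> ratZ;
  _ : coinduced_val \in additive_pred }.

HB.instance Definition _ := [isSub for coinduced_val].
HB.instance Definition _ := [Choice of coinduced by <:].
HB.instance Definition _ := [SubChoice_isSubZmodule of coinduced by <:].

Lemma coinducedD (f : coinduced) : {morph f : a b / a + b}.
Proof. exact/asboolP/(valP f). Qed.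

Lemma translate_additive (b : A) (f : coinduced) :
  (fun a => f (a * b)) \in additive_pred.
Proof. by apply/asboolP => x y; rewrite mulrDl coinducedD. Qed.

Let scale (b : A) (f : coinduced) := Coinduced (translate_additive b f).

Let scaleA a b v : scale a (scale b v) = scale (a * b) v.
Proof. by apply/val_inj/funext => c /=; rewrite mulrA. Qed.
Let scale1 : left_id 1 scale.
Proof. by move=> v; apply/val_inj/funext => c /=; rewrite mulr1. Qed.
Let scaleDr : right_distributive scale +%R.
Proof. by move=> a u v; apply/val_inj. Qed.
Let scaleDl v : {morph scale^~ v: a b / a + b}.
Proof. by move=> a b; apply/val_inj/funext => c /=; rewrite mulrDr coinducedD. Qed.

HB.instance Definition _ :=
  GRing.Zmodule_isLmodule.Build A coinduced scaleA scale1 scaleDr scaleDl.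

Lemma coinducedZ a (f : coinduced) : (a *: f) 1 = f a.
Proof. by rewrite -[RHS](congr1 f (mul1r a)). Qed.

Lemma coinducedMz (f : coinduced) (n : int) a : (f *~ n) a = f a *~ n.
Proof.
rewrite -[LHS]/(val (f *~ n) a) raddfMz.
by case: n => n; rewrite /intmul natmulfctE.
Qed.

(** The adjunction: x goes to the function a to u (a x), and evaluation at 1 recovers u. *)
Lemma coinduced_lift (X : lmodType A) (u : X -> ratZ) :
    {morph u : x y / x + y} ->
  exists h : {linear X -> coinduced}, forall x, h x 1 = u x.
Proof.
move=> uD; have hA x : (fun a : A => u (a *: x)) \in additive_pred.
  by apply/asboolP => a b; rewrite scalerDl uD.
have [|h hE] := @linear_exists A X coinduced (fun x => Coinduced (hA x)).
  move=> a x y; apply/val_inj/funext => b /=.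
  by rewrite !fctE -uD scalerDr scalerA.
by exists h => x; rewrite hE /= scale1r.
Qed.

Lemma coinduced_injective : injective_module coinduced.
Proof.
move=> U V g f gI.
have fD : {morph (fun u => f u 1) : x y / x + y} by move=> x y; rewrite linearD.
have [||h hE] := @ratZ_extend (zmodule V) [set vm | exists u, vm = (g u, f u 1)].
- split; first by exists 0; rewrite !linear0.
  move=> a _ _ [u ->] [v ->]; exists (u *~ a + v).
  rewrite !raddfD /= [g (u *~ a)]raddfMz [f (u *~ a)]raddfMz.
  by rewrite -[RHS]/(_, (f u *~ a) 1 + f v 1) coinducedMz -[f u 1 *~ a]scaler_int intz.
- by move=> m [u [/esym/eqP + ->]]; rewrite -(linear0 g) => /eqP/gI ->; rewrite linear0.
have [|k kE] := @coinduced_lift V h; first exact: (linearD h).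
exists k => u; apply/val_inj/funext => a; rewrite -[LHS]coinducedZ -[RHS]coinducedZ -!linearZ kE.
by apply: hE; exists (a *: u).
Qed.

End Coinduced.

(** [M] embeds in a power of the coinduced module, with one factor for each additive map from [M] to
    Q/Z; these maps separate points. *)
Lemma enough_injectives (A : pzRingType) (M : lmodType A) :
  exists (I : lmodType A) (i : {linear M -> I}), injective_module I /\ injective i.
Proof.
have chi (u : {linear zmodule M -> ratZ}) :
    exists h : {linear M -> coinduced A}, forall x, h x 1 = u x.
  exact/coinduced_lift/(linearD u).
have [h hE] := choice chi.
have [|i iE] := @linear_exists A M (_ -> coinduced A) (fun x u => h u x).
  by move=> a x y; apply/funext => u; rewrite linearP.
exists ({linear zmodule M -> ratZ} -> coinduced A), i; split.
  exact/product_injective/coinduced_injective.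
apply: linear_injP => x ix0; apply: contrapT => /(@ratZ_separates (zmodule M))[u].
by rewrite -hE => ux; apply: ux; move: ix0; rewrite iE => /(congr1 (@^~ u)) ->.
Qed.

(** * Left artinian rings *)

Section Ideals.
Variable A : pzRingType.
Local Notation J := (@in_jacobson_radical A).

Definition maximal_ideal (m : set A^o) : Prop :=
  [/\ submodule m, ~ m 1 &
    forall K : set A^o, submodule K -> m `<=` K -> ~ K 1 -> K `<=` m].

Lemma jacobson_radicalP a :
  J a <-> forall m : set A^o, maximal_ideal m -> m a.
Proof.
split=> [Ja m [sm m1 maxm]|Ja I [sI I1 maxI]].
  suff /Ja/asboolP : maximal_left_ideal [pred x : A^o | `[< m x >]] by [].
  split; [exact: submodule_pred|exact/asboolPn|] => K sK mK K1 x Kx.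
  apply/asboolP; apply: (maxm _ (pred_submodule sK)) => // [y my|] /=.
    by apply: mK; apply/asboolP.
  exact/negP.
apply: (Ja [set x | x \in I]); split; [exact: pred_submodule|exact/negP|].
move=> K sK IK K1 x Kx; apply: (maxI _ (submodule_pred sK)).
- by move=> y /IK Ky; apply/asboolP.
- exact/asboolPn.
- exact/asboolP.
Qed.

Lemma submodule_mulr (S : set A^o) (b : A) :
  submodule S -> submodule [set a : A^o | S (a * b)].
Proof.
move=> sS; split=> [|a x y Sx Sy] /=; first by rewrite mul0r; exact: submodule0 sS.
by rewrite -[a *: x]/(a * x) mulrDl -mulrA; apply: sS.2.
Qed.

Lemma submodule_scaler (V : lmodType A) (S : set V) (v : V) :
  submodule S -> submodule ([set a : A | S (a *: v)] : set A^o).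
Proof.
move=> sS; split=> [|a x y Sx Sy] /=; first by rewrite scale0r; exact: submodule0 sS.
by rewrite scalerDl -scalerA; apply: sS.2.
Qed.

Lemma submodule_add_cyclic (V : lmodType A) (S : set V) (v : V) :
  submodule S -> submodule [set u | exists a : A, S (u - a *: v)].
Proof.
move=> sS; split; first by exists 0; rewrite scale0r subr0; exact: submodule0 sS.
move=> a x y [b Sx] [c Sy]; exists (a * b + c).
have -> : a *: x + y - (a * b + c) *: v = a *: (x - b *: v) + (y - c *: v).
  by rewrite scalerBr scalerA scalerDl opprD addrACA.
exact: sS.2.
Qed.

Lemma maximal_ideal_inv (m : set A^o) (x : A) :
  maximal_ideal m -> ~ m x -> exists c : A, m (1 - c * x).
Proof.
move=> [sm m1 maxm] mx; apply: contrapT => nc; apply: mx.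
apply: (maxm [set u | exists a : A, m (u - a *: (x : A^o))]).
- exact: submodule_add_cyclic.
- by move=> y my; exists 0; rewrite scale0r subr0.
- exact: nc.
- by exists 1; rewrite scale1r subrr; exact: submodule0 sm.
Qed.

Lemma submodule_jacobson : submodule (J : set A^o).
Proof.
split=> [|a x y /jacobson_radicalP Jx /jacobson_radicalP Jy];
  apply/jacobson_radicalP => m maxm; have [sm _ _] := maxm.
  exact: submodule0.
by apply: sm.2; [apply: Jx | apply: Jy].
Qed.

Lemma jacobson_mulr a b : J a -> J (a * b).
Proof.
move=> /jacobson_radicalP Ja; apply/jacobson_radicalP => m maxm.
have [sm m1 _] := maxm.
have [mb|mb] := pselect (m b); first exact: (submoduleZ sm).
apply: (Ja [set c | m (c * b)]); split.
- exact: submodule_mulr.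
- by rewrite /= mul1r.
move=> K sK mK K1 k Kk /=; apply: contrapT => /(maximal_ideal_inv maxm)[c mc].
(* (1 - b c k) b = b (1 - c k b) lies in m by the choice of c. *)
have : K (1 - b * c * k).
  apply: mK; rewrite /= mulrBl mul1r -!mulrA -[X in X - _]mulr1 -mulrBr.
  exact: (submoduleZ sm).
move=> /(submoduleD sK) /(_ (submoduleZ sK (b * c) Kk)).
by rewrite -[_ *: k]/(b * c * k) subrK.
Qed.

(** The descending chain condition for left ideals, in the form of the minimum condition. *)
Definition dcc : Prop :=
  forall F : set (set A^o), F !=set0 -> (forall N, F N -> submodule N) ->
  exists N, F N /\ forall N', F N' -> N' `<=` N -> N `<=` N'.

Hypothesis dccA : dcc.

(** Let L0 be the annihilator of v modulo [N] and L minimal among the left ideals strictly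
    containing L0. Then L/L0 is simple, and any b in L outside L0 makes b v generate a simple module
    modulo [N]. *)
Lemma simple_multiple (V : lmodType A) (N : set V) :
  submodule N -> forall v, ~ N v ->
  exists b : A, ~ N (b *: v) /\ maximal_ideal [set a : A | N (a *: (b *: v))].
Proof.
move=> sN v Nv; pose L0 : set A^o := [set a : A | N (a *: v)].
have sL0 : submodule L0 by exact: submodule_scaler.
have [||L [[sL L0L [b Lb L0b]] minL]] :=
    @dccA [set L | [/\ submodule L, L0 `<=` L & exists2 b, L b & ~ L0 b]].
- by exists setT; split=> //; exists 1; rewrite /L0 //= scale1r.
- by move=> L [].
exists b; split=> //; split; [exact: submodule_scaler|by rewrite /= scale1r|].
move=> K sK NK K1 k Kk /=; apply: contrapT => Nkb; apply: K1.
(* K b + L0 lies inside L and contains k b, which is outside L0; by minimality it contains b, which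
   forces 1 into K. *)
pose L1 : set A^o := [set x | exists2 c, K c & L0 (x - c * b)].
have /minL/(_ _ _ Lb)[|c Kc] : [/\ submodule L1, L0 `<=` L1 & exists2 b, L1 b & ~ L0 b].
- split.
  + split; first by exists 0; rewrite ?mul0r ?subr0; apply: submodule0.
    move=> a x y [c Kc Lx] [d Kd Ly]; exists (a * c + d); first exact: sK.2.
    have -> : a *: x + y - (a * c + d) * b = a *: (x - c * b : A^o) + (y - d * b).
      by rewrite scalerBr mulrDl opprD addrACA -[a *: (c * b : A^o)]/(a * (c * b)) mulrA.
    exact: sL0.2.
  + by move=> x Lx; exists 0; rewrite ?mul0r ?subr0 //; apply: submodule0.
  + exists (k * b); last by rewrite /L0 /= -scalerA.
    by exists k; rewrite ?subrr //; exact: submodule0 sL0.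
- move=> x [c Kc] /L0L Lx; rewrite -[x](subrK (c * b)); apply: (submoduleD sL) => //.
  exact: (submoduleZ sL).
rewrite /L0 /= scalerBl -scalerA -[X in X - _]scale1r -scalerBl => /NK K1c.
by rewrite -[1](subrK c); apply: submoduleD.
Qed.

(** Take L minimal among the left ideals not inside m, and e in L congruent to 1 modulo m. If x = a
    e, with a in m, escaped a maximal m', then either L meets m' inside m, and e (1 - d x) in m
    gives 1 in m, or minimality puts L, hence x, inside m'. Since 1 - e is in m, e is idempotent
    modulo J. *)
Lemma maximal_ideal_idem (m : set A^o) : maximal_ideal m ->
  exists e : A, m (1 - e) /\ forall a : A, m a -> J (a * e).
Proof.
move=> maxm; have [sm m1 _] := maxm.
have [||L [[sL [b Lb mb]] minL]] :=
    @dccA [set L | submodule L /\ exists2 b, L b & ~ m b].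
- by exists setT; split=> //; exists 1.
- by move=> L [].
have [c mcb] := maximal_ideal_inv maxm mb; exists (c * b); set e := c * b in mcb *.
have Le : L e by exact: (submoduleZ sL).
split=> // a ma; set x := a * e.
have Lx : L x by exact: (submoduleZ sL).
have mx : m x.
  rewrite -[x](subKr a) /x -[X in _ - (X - _)]mulr1 -mulrBr.
  by apply: (submoduleB sm) => //; apply: (submoduleZ sm).
apply/jacobson_radicalP => m' maxm'; have [sm' _ _] := maxm'.
apply: contrapT => /(maximal_ideal_inv maxm')[d m'd].
have sI : submodule (L `&` m').
  by split=> [|y u v [Lu mu] [Lv mv]]; split;
    [exact: submodule0|exact: submodule0|exact: sL.2|exact: sm'.2].
have [sub|] := pselect (L `&` m' `<=` m).
  apply: m1; rewrite -[1](subrK e); apply: (submoduleD sm) => //.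
  rewrite -[e](subrK (e * (d * x))); apply: (submoduleD sm); last first.
    by rewrite mulrA; apply: (submoduleZ sm).
  apply: sub; split; last by rewrite -[X in X - _]mulr1 -mulrBr; apply: (submoduleZ sm').
  by apply: (submoduleB sL) => //; rewrite mulrA; apply: (submoduleZ sL).
move=> /existsNP[y /not_implyP[[Ly m'y] my]].
have : L `<=` L `&` m'.
  by apply: minL; [split=> //; exists y | move=> z []].
move=> /(_ _ Lx)[_ m'x].
have [_ + _] := maxm'; apply; rewrite -[1](subrK (d * x)).
by apply: (submoduleD sm') => //; apply: (submoduleZ sm').
Qed.

Section RadicalQuotient.
Variables (A0 : lmodType A) (p : {linear A^o -> A0}).
Hypothesis p_surj : surjective_fun p.
Hypothesis p_ker : forall a, p a = 0 <-> J a.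

Lemma artin_baer (M : lmodType A) :
    (forall f : {linear ker p -> M}, exists m0, forall j, f j = (val j : A) *: m0) ->
  injective_module M.
Proof.
move=> extM; apply: (@baer_injective _ _ maximal_ideal).
  by move=> V N sN v Nv; exact: simple_multiple.
move=> G sG fG maxm; set m : set A^o := [set a | _] in maxm.
have [e [me Je]] := maximal_ideal_idem maxm.
have fun2 a x y : G (a, x) -> G (a, y) -> x = y.
  move=> Gx Gy; apply/eqP; rewrite -subr_eq0; apply/eqP/fG.
  by have := submoduleB sG Gx Gy; congr G; congr pair; rewrite /= subrr.
have [||| f fE] := @graph_linear A (ker p) M [set jx | G (val jx.1, jx.2)].
- split=> [|a [j x] [k y] Gx Gy]; first exact: submodule0 sG.
  by have := sG.2 a _ _ Gx Gy.
- by move=> x /fG.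
- move=> j; have /p_ker/jacobson_radicalP Jj : p (val j) = 0 by apply/eqP/(valP j).
  exact: Jj maxm.
have [m0 m0E] := extM f; have [m1 Gm1] := me.
(* For a in m write a = a e + a (1 - e): the first summand lies in J, where the map is
   multiplication by m0, and m1 is the value at 1 - e. *)
exists (e *: m0 + m1) => a x Gax; apply: (fun2 a) => //.
have Jae : J (a * e) by apply: Je; exists x.
have kae : (a * e : A^o) \in kerp p by apply/eqP/p_ker.
have := fE (Ker kae); rewrite m0E /= => Gae.
have := submoduleD sG Gae (submoduleZ sG a Gm1); congr G; congr pair => /=.
  by rewrite -[a *: _]/(a * _) mulrBr mulr1 addrC subrK.
by rewrite scalerDr scalerA.
Qed.

Definition simple_module (T : lmodType A) : Prop :=
  (exists t : T, t <> 0) /\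
  forall t u : T, t <> 0 -> exists a : A, u = a *: t.

Lemma simple_annihilator (T : lmodType A) (t : T) :
  simple_module T -> t <> 0 -> maximal_ideal ([set a : A | a *: t = 0] : set A^o).
Proof.
move=> [_ genT] t0; split; [exact: submodule_scaler t (submodule0set T)|by rewrite /= scale1r|].
move=> K sK tK K1 k Kk; apply: contrapT => kt; apply: K1.
have [c tE] := genT _ t kt.
rewrite -[1](subrK (c * k)); apply: (submoduleD sK); last exact: (submoduleZ sK).
by apply: tK; rewrite /= scalerBl scale1r -scalerA -tE subrr.
Qed.

(** With m the annihilator of t and e as above, a t to p (a e) is well defined because m e lies in
    J, and it splits p a to a t because e t = t. *)
Lemma simple_retract (T : lmodType A) : simple_module T ->
  exists (q : {linear A0 -> T}) (s : {linear T -> A0}), forall t, q (s t) = t.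
Proof.
move=> simT; have [[t t0] genT] := simT.
have maxm := simple_annihilator simT t0.
have [e [me Je]] := maximal_ideal_idem maxm.
have [|f fE] := @linear_exists A A^o T (fun a : A => a *: t).
  by move=> a x y; rewrite scalerDl scalerA.
have [|g gE] := @linear_exists A A^o A0 (fun a : A => p (a * e)).
  by move=> a x y; rewrite -linearP -[a *: x]/(a * x) mulrDl -mulrA.
have fS : surjective_fun f by move=> u; have [a ->] := genT t u t0; exists a.
have [a|q qE] := @factor_surj A A^o A0 T p f p_surj.
  by move=> /p_ker/jacobson_radicalP/(_ _ maxm) at0; rewrite fE.
have [a|s sE] := @factor_surj A A^o T A0 f g fS.
  by rewrite fE gE => /Je Jae; apply/p_ker.
exists q, s => u; have [a <-] := fS u.
rewrite sE gE qE !fE -scalerA; congr (_ *: _).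
by move: me; rewrite /= scalerBl scale1r => /eqP; rewrite subr_eq0 eq_sym => /eqP.
Qed.

End RadicalQuotient.

(** Q/N0 is killed by J, hence semisimple, so a submodule of [Q] maximal among those containing [N0]
    and avoiding x has a simple quotient. The last clause of the conclusion expresses this
    simplicity. *)
Lemma max_submodule_over_radical (V : lmodType A) (Q N0 : set V) (x : V) :
    submodule Q -> submodule N0 -> N0 `<=` Q ->
    (forall (j : A) q, J j -> Q q -> N0 (j *: q)) -> Q x -> ~ N0 x ->
  exists N, [/\ submodule N, N0 `<=` N, N `<=` Q, ~ N x &
    forall y q, Q y -> ~ N y -> Q q -> exists a : A, N (q - a *: y)].
Proof.
move=> sQ sN0 N0Q JQ Qx N0x.
have [|N [sN N0N NB maxN]] :=
    @max_submodule A V N0 [set v | v = x \/ ~ Q v] sN0.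
  by move=> v N0v [vx|]; [apply: N0x; rewrite -vx | apply; apply: N0Q].
have NQ : N `<=` Q by move=> v /NB nB; apply: contrapT => Qv; apply: nB; right.
have Nx : ~ N x by move=> /NB; apply; left.
exists N; split=> // y q Qy Ny Qq.
have step1 z : Q z -> ~ N z -> exists a : A, N (x - a *: z).
  move=> Qz Nz; apply: contrapT => nK; apply: Nz.
  apply: (maxN _ (submodule_add_cyclic z sN)) => /=.
  - by move=> v Nv; exists 0; rewrite scale0r subr0.
  - move=> v [a Nv] [vx|]; first by apply: nK; exists a; rewrite -vx.
    apply; rewrite -[v](subrK (a *: z)).
    by apply: (submoduleD sQ); [apply: NQ | apply: (submoduleZ sQ)].
  - by exists 1; rewrite scale1r subrr; exact: submodule0 sN.
(* Otherwise some multiple w of q is simple modulo K = N + A x. As e w is not in N, x is congruent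
   to some a e w, and a e then annihilates w modulo K; this places a e in J and x in N. *)
have [c Nc] : exists c : A, N (q - c *: x).
  apply: contrapT => nK.
  have sK := submodule_add_cyclic x sN; set K := [set u | _] in sK nK.
  have [b [Kw maxm]] := simple_multiple sK nK.
  set w := b *: q in Kw maxm; set m := [set a | _] in maxm.
  have [e [me Je]] := maximal_ideal_idem maxm.
  have Qw : Q w by exact: (submoduleZ sQ).
  have NK : N `<=` K by move=> v Nv; exists 0; rewrite scale0r subr0.
  have Kx : K x by exists 1; rewrite scale1r subrr; exact: submodule0 sN.
  have [|a Na] := step1 (e *: w) (submoduleZ sQ e Qw).
    move=> /NK Kew; apply: Kw; rewrite -[w](subrK (e *: w)).
    by apply: (submoduleD sK) => //; move: me; rewrite /m /= scalerBl scale1r.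
  have mae : m (a * e).
    rewrite /m /= -scalerA -[_ *: _](subKr x); apply: (submoduleB sK) => //.
    exact: NK.
  have Jae : J (a * e).
    (* a e = a (1 - e) e + (a e) e, and both 1 - e and a e lie in m. *)
    rewrite -[e in a * e](subrK (e * e)) mulrDr mulrA.
    apply: (submoduleD submodule_jacobson); last exact: Je.
    rewrite -[X in X - _]mul1r -mulrBl; apply: (submoduleZ submodule_jacobson).
    exact: Je.
  apply: Nx; rewrite -[x](subrK (a *: (e *: w))); apply: (submoduleD sN) => //.
  by apply: N0N; rewrite scalerA; apply: JQ.
have [a Na] := step1 y Qy Ny; exists (c * a).
rewrite -[q - _](subrKA (c *: x)); apply: (submoduleD sN) => //.
by rewrite -scalerA -scalerBr; apply: (submoduleZ sN).
Qed.

(** * Nilpotence and finite generation of the radical *)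

Fixpoint radical_power (n : nat) : set A^o :=
  if n is n'.+1 then
    [set v | forall T : set A^o, submodule T ->
      (forall i j : A, radical_power n' i -> J j -> T (i * j)) -> T v]
  else setT.

Lemma submodule_radical_power n : submodule (radical_power n).
Proof.
case: n => [//|n]; split=> [T sT _|a x y Ix Iy T sT IT]; first exact: submodule0.
by apply: sT.2; [apply: Ix | apply: Iy].
Qed.

Lemma radical_power_mulr n (a b : A) :
  radical_power n a -> radical_power n (a * b).
Proof.
case: n => [//|n] Ia.
apply: (Ia _ (submodule_mulr b (submodule_radical_power n.+1))) => i j Ii Jj /=.
by move=> T sT IT; rewrite -mulrA; apply: IT => //; apply: jacobson_mulr.
Qed.

(** Let I be the power where the sequence stabilises and N the set of a with I a = 0. If 1 were not
    in N, some b would be simple modulo N, so J b would lie in N and I b = (I J) b = 0 would put b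
    in N. *)
Lemma radical_power_nil : exists n, forall a, radical_power n a -> a = 0.
Proof.
have [||_ [[n _ <-] minI]] := @dccA [set I | exists2 n, True & radical_power n = I].
- by exists setT, 0.
- by move=> _ [n _ <-]; exact: submodule_radical_power.
exists n; set I := radical_power n in minI *.
have II : I `<=` radical_power n.+1.
  apply: minI; first by exists n.+1.
  move=> a Ia; apply: Ia; first exact: submodule_radical_power.
  by move=> i j Ii _; apply: radical_power_mulr.
pose N : set A^o := [set a | forall i, I i -> i * a = 0].
have sN : submodule N.
  split=> [i _|a x y Nx Ny i Ii]; first by rewrite mulr0.
  rewrite mulrDr (Ny i Ii) addr0 -[a *: x]/(a * x) mulrA; apply: Nx.
  exact: radical_power_mulr.
suff N1 : N 1 by move=> a /N1; rewrite mulr1.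
apply: contrapT => /(simple_multiple sN)[b [Nb maxm]]; apply: Nb => i Ii.
apply: (II _ Ii [set c | c * (b *: (1 : A^o)) = 0]).
  exact: (@submodule_scaler A^o _ (b *: (1 : A^o)) (submodule0set A^o)).
move=> j k Ij /jacobson_radicalP/(_ _ maxm)/(_ _ Ij) /=.
by rewrite -[k *: _]/(k * _) mulrA.
Qed.

(** The hypothesis encodes that S is contained in L + J S. As J is nilpotent, no finiteness of S is
    required: if J^(k+1) S lies in L then so does J^k S, down to k = 0. *)
Lemma nakayama (V : lmodType A) (L S : set V) : submodule L ->
    (forall s, S s -> forall T, submodule T -> L `<=` T ->
      (forall (j : A) s', J j -> S s' -> T (j *: s')) -> T s) ->
  S `<=` L.
Proof.
move=> sL gen; have [n nil] := radical_power_nil.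
pose good k := forall i : A, radical_power k i -> forall s, S s -> L (i *: s).
have down k : good k.+1 -> good k.
  move=> IH i Ii s Ss.
  apply: (gen s Ss [set t | forall i : A, radical_power k i -> L (i *: t)]) => //.
  - split=> [j _|a x y Lx Ly j Ij] /=; first by rewrite scaler0; exact: submodule0 sL.
    rewrite scalerDr scalerA; apply: (submoduleD sL); last exact: Ly.
    exact/Lx/radical_power_mulr.
  - by move=> l Ll j _; exact: (submoduleZ sL).
  - by move=> j s' Jj Ss' k' Ik' /=; rewrite scalerA; apply: IH => // T sT; apply.
suff good0 : good 0%N by move=> s Ss; rewrite -[s]scale1r; apply: good0.
have : good n by move=> i /nil -> s _; rewrite scale0r; exact: submodule0 sL.
by elim: n {nil} => // n IHn /down.
Qed.

Definition spanned_by (V : lmodType A) (l : seq V) : set V :=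
  [set v | forall T, submodule T -> (forall x, x \in l -> T x) -> T v].

Lemma submodule_spanned_by (V : lmodType A) (l : seq V) : submodule (spanned_by l).
Proof.
split=> [T sT _|a x y lx ly T sT lT]; first exact: submodule0 sT.
by apply: sT.2; [apply: lx | apply: ly].
Qed.

(** Among the left ideals N between J^2 and J that generate J together with finitely many elements,
    a minimal one is J^2: otherwise one more generator x allows a smaller N. Nakayama's lemma then
    removes J^2. *)
Lemma jacobson_finitely_generated :
  exists l : seq A^o, forall a, J a <-> spanned_by l a.
Proof.
pose J2 : set A^o := [set v | forall T : set A^o, submodule T ->
  (forall i j : A, J i -> J j -> T (i * j)) -> T v].
have sJ2 : submodule J2.
  split=> [T sT _|a x y Ix Iy T sT IT]; first exact: submodule0 sT.
  by apply: sT.2; [apply: Ix | apply: Iy].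
have sJ := submodule_jacobson.
have [||N [[sN NJ J2N [l [lJ lN]]] minN]] := @dccA [set N | [/\ submodule N,
    N `<=` (J : set A^o), J2 `<=` N & exists l : seq A^o, (forall x, x \in l -> J x) /\
    forall T : set A^o, submodule T -> (forall x, x \in l -> T x) ->
      N `<=` T -> (J : set A^o) `<=` T]].
- exists J; split=> //; last by exists [::].
  by move=> v; apply=> // i j Ji Jj; exact: jacobson_mulr.
- by move=> N [].
have NJ2 : N `<=` J2.
  move=> x Nx; apply: contrapT => J2x.
  have [|N' [sN' J2N' N'N N'x gen]] := max_submodule_over_radical sN sJ2 J2N _ Nx J2x.
    by move=> j q Jj /NJ Jq T sT; apply.
  have /minN/(_ N'N _ Nx) // : [/\ submodule N', N' `<=` (J : set A^o), J2 `<=` N' &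
      exists l : seq A^o, (forall x, x \in l -> J x) /\
      forall T : set A^o, submodule T -> (forall x, x \in l -> T x) ->
      N' `<=` T -> (J : set A^o) `<=` T].
  split=> //; first by move=> z /N'N /NJ.
  exists (x :: l); split.
    by move=> z; rewrite inE => /orP[/eqP ->|/lJ //]; exact: NJ.
  move=> T sT lT N'T; apply: lN => //.
    by move=> z zl; apply: lT; rewrite inE zl orbT.
  move=> q Nq; have [a Na] := gen x q Nx N'x Nq.
  rewrite -[q](subrK (a *: x)); apply: (submoduleD sT); first exact: N'T.
  by apply: (submoduleZ sT); apply: lT; rewrite inE eqxx.
exists l => a; split=> [Ja|]; last by apply.
suff: (J : set A^o) `<=` spanned_by l by apply.
apply: nakayama; first exact: submodule_spanned_by.
move=> s Js T sT lT JT; apply: lN => //.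
  by move=> x xl; apply: lT => U sU; apply.
by move=> x /NJ2; apply.
Qed.

End Ideals.

(** * Artin algebras satisfy the descending chain condition on left ideals *)

Section ArtinAlgebraChains.
Variable R : comPzRingType.

Fixpoint lin_span (M : lmodType R) (l : seq M) : set M :=
  if l is x :: l' then [set y | exists c z, lin_span l' z /\ y = c *: x + z]
  else [set 0].

Lemma submodule_lin_span (M : lmodType R) (l : seq M) : submodule (lin_span l).
Proof.
elim: l => [|x l IHl] /=; first by split=> // a _ _ -> ->; rewrite scaler0 addr0.
split; first by exists 0, 0; rewrite scale0r addr0; split=> //; case: IHl.
move=> a _ _ [c [z [lz ->]]] [d [w [lw ->]]].
exists (a * c + d), (a *: z + w); split; first exact: IHl.2.
by rewrite scalerDr scalerDl scalerA addrACA.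
Qed.

Lemma sum_lin_span (M : lmodType R) (I : Type) (r : seq I) (s : I -> M) c :
  lin_span (map s r) (\sum_(i <- r) c i *: s i).
Proof.
elim: r => [|i r IHr] /=; first by rewrite big_nil.
by rewrite big_cons; exists (c i), (\sum_(j <- r) c j *: s j).
Qed.

Hypothesis artR : artinian R.

(** Induction on the generators: on the span of [x :: l] the chain is controlled by its trace on the
    span of [l] and by the ideals [I n] of coefficients of x. *)
Lemma artinian_chain (M : lmodType R) (N : nat -> set M) (l : seq M) :
    (forall n, submodule (N n)) -> (forall m n, (m <= n)%N -> N n `<=` N m) ->
  exists n, forall m, (n <= m)%N -> forall y, lin_span l y -> N n y -> N m y.
Proof.
move=> sN decN; elim: l => [|x l [n1 n1E]].
  by exists 0%N => m _ _ -> _; exact: submodule0 (sN m).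
have sl := submodule_lin_span l.
pose I n : set R^o := [set c : R | exists z, lin_span l z /\ N n (c *: x + z)].
have sI n : submodule (I n).
  split; first by exists 0; rewrite scale0r addr0; split; exact: submodule0.
  move=> a c d [z [lz Nz]] [w [lw Nw]]; exists (a *: z + w); split; first exact: sl.2.
  by have := (sN n).2 a _ _ Nz Nw; rewrite scalerDr scalerDl addrACA scalerA.
have [|n|n2 n2E] := artR (I := fun n => [pred c : R^o | `[< I n c >]]).
- by move=> n; exact: submodule_pred.
- move=> c /asboolP[z [lz Nz]]; apply/asboolP; exists z; split=> //.
  exact: decN (leqnSn n) _ Nz.
exists (maxn n1 n2) => m; rewrite geq_max => /andP[n1m n2m] _ [c [z [lz ->]]] Nn.
have Imax : I (maxn n1 n2) c by exists z.
have /asboolP[w [lw Nw]] : c \in [pred c : R^o | `[< I m c >]].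
  by rewrite n2E // -(n2E _ (leq_maxr n1 n2)); apply/asboolP.
(* Two elements with the same coefficient c differ by z - w in the span of [l], where the chain is
   already stationary. *)
rewrite -[z](subrK w) addrC -addrA [w + _]addrC; apply: (submoduleD (sN m)) => //.
apply: (n1E _ n1m); first exact: submoduleB.
apply: (decN _ _ (leq_maxl n1 n2)).
have -> : z - w = (c *: x + z) - (c *: x + w) by rewrite opprD addrACA subrr add0r.
by apply: (submoduleB (sN _)) => //; apply: decN Nw; rewrite geq_max n1m.
Qed.

Lemma artin_algebra_dcc (A : algType R) : finitely_generated A -> dcc A.
Proof.
move=> [k [s gen]] F F0 sF; apply: contrapT => nomin.
have {nomin} next (N : {N | F N}) :
    exists N' : {N | F N}, sval N' `<=` sval N /\ ~ sval N `<=` sval N'.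
  apply: contrapT => nonext; apply: nomin; exists (sval N); split; first exact: svalP.
  move=> N' FN' N'N; apply: contrapT => NN'; apply: nonext.
  by exists (exist _ N' FN').
have [f fE] := choice next; have [N0 FN0] := F0.
pose N n := sval (iter n f (exist _ N0 FN0)).
have decN m n : (m <= n)%N -> N n `<=` N m.
  move=> /subnK <-; elim: (n - m)%N => // {}n IHn x Nx.
  by apply: IHn; exact: (fE _).1.
have sN n : submodule (N n : set A).
  have sub : submodule (N n) by apply/sF/svalP.
  split=> [|a x y Nx Ny]; first exact: submodule0 sub.
  (* A left ideal is an R-submodule because scalars act through multiples of 1. *)
  by have := sub.2 (a *: 1) _ _ Nx Ny; rewrite -[_ + _]/((a *: 1) * x + y) -scalerAl mul1r.
have [n nE] := artinian_chain (map s (index_enum 'I_k)) sN decN.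
have [_] := fE (iter n f (exist _ N0 FN0)); apply=> y Ny.
apply: (nE n.+1) => //; have [c ->] := gen y.
exact: sum_lin_span.
Qed.

End ArtinAlgebraChains.

(** * Vanishing of Ext and injective dimension *)

Section Homology.
Variable A : pzRingType.
Implicit Types U V W M N I C X Y : lmodType A.

Definition short_exact U V W (i : {linear U -> V}) (p : {linear V -> W}) :=
  [/\ injective i, surjective_fun p & forall v, p v = 0 <-> exists u, i u = v].

Lemma injective_extend_along U V I (d : {linear U -> V}) (f : {linear U -> I}) :
    injective_module I -> (forall u, d u = 0 -> f u = 0) ->
  exists h : {linear V -> I}, forall u, h (d u) = f u.
Proof.
move=> injI kf.
have [T [i [iI iT]]] := submodule_exists (submodule_im d (submoduleT U)).
have [w|d' d'E] := factor_inj (f := d) iI.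
  by apply/iT; exists w.
have [||h hE] := @factor_surj A U T I d' f.
- by move=> t; have [|u _ du] := (iT (i t)).2; [exists t|exists u; apply: iI; rewrite d'E].
- by move=> u d'u0; apply: kf; rewrite -d'E d'u0 linear0.
have [k kE] := injI _ _ i h iI.
by exists k => u; rewrite -d'E kE hE.
Qed.

Lemma injective_presentation M : exists I C (i : {linear M -> I}) (p : {linear I -> C}),
  injective_module I /\ short_exact i p.
Proof.
have [I [i [injI iI]]] := enough_injectives M.
have [C [p [pS pK]]] := quotient_exists (submodule_im i (submoduleT M)).
exists I, C, i, p; split=> //; split=> // v; rewrite pK.
by split=> [[u _ <-]|[u <-]]; exists u.
Qed.

(** Recursion on the cosyzygy turns dimension shifting into induction on k. *)
Fixpoint inj_dim_le k M : Prop :=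
  if k is k'.+1 then
    exists I C (i : {linear M -> I}) (p : {linear I -> C}),
      [/\ injective_module I, short_exact i p & inj_dim_le k' C]
  else injective_module M.

(* Ext^(k+1)(X, M) = 0, computed from the projective resolution P of X *)
Definition ext_zero X (P : proj_resolution X) k M : Prop :=
  forall f : {linear pr_obj P k.+1 -> M}, (forall y, f (pr_d P k.+1 y) = 0) ->
  exists g : {linear pr_obj P k -> M}, forall x, f x = g (pr_d P k x).

Section ExtSequence.
Variables (X : lmodType A) (P : proj_resolution X).

Lemma pr_dd k y : pr_d P k (pr_d P k.+1 y) = 0.
Proof. by apply/pr_exactS; exists y. Qed.

Lemma ext_zero_injective k I : injective_module I -> ext_zero P k I.
Proof.
move=> injI f fd0; have [|h hE] := injective_extend_along (d := pr_d P k) (f := f) injI.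
  by move=> u /pr_exactS[y <-].
by exists h => x; rewrite hE.
Qed.

Variables (U V W : lmodType A) (i : {linear U -> V}) (p : {linear V -> W}).
Hypothesis ses : short_exact i p.

(** Exactness of Ext^(k+1)(X, V) -> Ext^(k+1)(X, W) -> Ext^(k+2)(X, U): a lift f1 of f to V has f1 d
    in U, where it equals g d, and f1 - i g is a cocycle. *)
Lemma ext_zero_quotient k : ext_zero P k V -> ext_zero P k.+1 U -> ext_zero P k W.
Proof.
have [iI pS pK] := ses; move=> EV EU f fd0.
have [f1 f1E] := pr_projective f pS.
have [y|u uE] := factor_inj (f := f1 \o pr_d P k.+1) iI.
  by apply/pK; rewrite /= f1E.
have [y|g gE] := EU u.
  by apply: iI; rewrite uE /= pr_dd !linear0.
have [y|h hE] := EV (f1 \- (i \o g)).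
  by rewrite /= -gE uE subrr.
exists (p \o h) => x /=; rewrite -hE /= linearB f1E.
have -> : p (i (g x)) = 0 by apply/pK; exists (g x).
by rewrite subr0.
Qed.

(** Exactness of Ext^(k+1)(X, W) -> Ext^(k+2)(X, U) -> Ext^(k+2)(X, V): from i f = h d and p h = w
    d, lift w to w1; then h - w1 d takes values in U and bounds f. *)
Lemma ext_zero_sub k : ext_zero P k W -> ext_zero P k.+1 V -> ext_zero P k.+1 U.
Proof.
have [iI pS pK] := ses; move=> EW EV f fd0.
have [y|h hE] := EV (i \o f); first by rewrite /= fd0 linear0.
have [y|w wE] := EW (p \o h).
  by rewrite /= -hE; apply/pK; exists (f y).
have [w1 w1E] := pr_projective w pS.
have [x|g gE] := factor_inj (f := h \- (w1 \o pr_d P k)) iI.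
  by apply/pK; rewrite /= linearB w1E -wE subrr.
exists g => x; apply: iI; rewrite gE /= -hE.
by rewrite pr_dd linear0 subr0.
Qed.

End ExtSequence.

Lemma ext_zero_retract X (P : proj_resolution X) k M N
    (q : {linear M -> N}) (s : {linear N -> M}) :
  (forall x, q (s x) = x) -> ext_zero P k M -> ext_zero P k N.
Proof.
move=> qs EM f fd0; have [y|g gE] := EM (s \o f); first by rewrite /= fd0 linear0.
by exists (q \o g) => x; rewrite /= -gE /= qs.
Qed.

Lemma ext_zero_inj_dim X (P : proj_resolution X) k M :
  inj_dim_le k M -> forall j, (k <= j)%N -> ext_zero P j M.
Proof.
elim: k M => [|k IHk] M /=; first by move=> injM j _; exact: ext_zero_injective.
move=> [I [C [i [p [injI ses dimC]]]]] [//|j] kj.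
by apply: (ext_zero_sub ses); [exact: IHk | exact: ext_zero_injective].
Qed.

(** A family that detects injectivity through Ext^1 detects dimension at most k through Ext^(k+1),
    by shifting along M -> I -> C. It is applied to all modules and to A/J alone. *)
Lemma inj_dim_of_ext (T : Type) (X : T -> lmodType A)
    (P : forall t, proj_resolution (X t)) :
    (forall M, (forall t, ext_zero (P t) 0 M) -> injective_module M) ->
  forall k M, (forall t, ext_zero (P t) k M) -> inj_dim_le k M.
Proof.
move=> test; elim=> [|k IHk] M EM /=; first exact: test.
have [I [C [i [p [injI ses]]]]] := injective_presentation M.
exists I, C, i, p; split=> //; apply: IHk => t.
by apply: (ext_zero_quotient ses); [exact: ext_zero_injective | exact: EM].
Qed.

Lemma extend_of_ext X (P : proj_resolution X) M V (q : {linear V -> X})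
    (f : {linear ker q -> M}) :
    surjective_fun q -> ext_zero P 0 M ->
  exists h : {linear V -> M}, forall u : ker q, h (val u) = f u.
Proof.
move=> qS EM; have [b bE] := pr_projective (pr_aug P) qS.
have valL : linear (val : ker q -> V) by [].
have [v vE] := linear_exists valL.
have vI : injective v by move=> x y; rewrite !vE => /val_inj.
have qv u : q (v u) = 0 by rewrite vE; apply/eqP/(valP u).
have kerE x : q x = 0 -> exists u, v u = x.
  by move=> /eqP qx; exists (Ker (qx : x \in kerp q)); rewrite vE.
have [y|c cE] := factor_inj (f := b \o pr_d P 0) vI.
  by apply: kerE; rewrite /= bE; apply/pr_exact0; exists y.
have [y|g gE] := EM (f \o c).
  rewrite /= (_ : c _ = 0) ?linear0 //.
  by apply: vI; rewrite cE /= pr_dd !linear0.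
(* V is the sum of the image of b and ker q, so the extension is prescribed by g on the one and f on
   the other; they agree on the overlap, which is the image of the first differential. *)
pose G : set (V * M) := [set xm | exists x u, xm = (b x - v u, g x - f u)].
have [|||h hE] := @graph_linear A V M G.
- split; first by exists 0, 0; rewrite !linear0 !addr0.
  move=> a _ _ [x [u ->]] [y [w ->]]; exists (a *: x + y), (a *: u + w).
  by congr pair; rewrite /= scalerDr !linearP addrACA.
- move=> m [x [u [/esym/eqP + ->]]]; rewrite subr_eq0 => /eqP bx.
  have [y xE] : exists y, pr_d P 0 y = x by apply/pr_exact0; rewrite -bE bx qv.
  rewrite -xE -gE /=; apply/eqP; rewrite subr_eq0; apply/eqP; congr (f _).
  by apply: vI; rewrite cE /= xE.
- move=> x; have [y yE] := pr_aug_surj P (q x).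
  have [|u uE] := kerE (b y - x); first by rewrite linearB bE yE subrr.
  by exists (g y - f u), y, u; rewrite uE subKr.
exists h => u; have [x [w [uE ->]]] := hE (val u).
have [y xE] : exists y, pr_d P 0 y = x.
  apply/pr_exact0; rewrite -bE -[b x](subrK (v w)) -uE linearD qv addr0.
  by rewrite -vE qv.
rewrite -xE -gE /= -linearB; congr (f _); apply: vI.
by rewrite linearB cE /= xE -uE vE.
Qed.

Lemma injective_of_ext M :
    (forall X, exists P : proj_resolution X, ext_zero P 0 M) ->
  injective_module M.
Proof.
move=> EM U V g f gI.
have [X [q [qS qK0]]] := quotient_exists (submodule_im g (submoduleT U)).
have qK v : q v = 0 <-> exists u, g u = v.
  by rewrite qK0; split=> [[u _ <-]|[u <-]]; exists u.
have gq u : g u \in kerp q by apply/eqP/qK; exists u.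
have [P EP] := EM X.
have valL : linear (val : ker q -> V) by [].
have [v vE] := linear_exists valL.
have [k|c cE] := factor_inj (f := v) gI.
  by apply/qK; rewrite vE; apply/eqP/(valP k).
have [h hE] := extend_of_ext (f \o c) qS EP.
exists h => u; have := hE (Ker (gq u)); rewrite /= => ->; congr (f _).
by apply: gI; rewrite cE vE.
Qed.
End Homology.

(** * Dimensions and resolutions *)

Lemma eq_einf (P Q : nat -> Prop) : (forall n, P n <-> Q n) -> einf P = einf Q.
Proof. by move=> PQ; congr einf; apply/funext => n; apply/propext. Qed.

Section Dimensions.
Variable A : pzRingType.
Implicit Types U V W M N I C X Y : lmodType A.

Definition zero_map U V : {linear U -> V} := [the {linear U -> V} of \0].

Lemma zero_module_exists : exists Z : lmodType A, zero_module Z.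
Proof.
by exists (ker (idfun : {linear A^o -> A^o})) => x; apply/val_inj/eqP/(valP x).
Qed.

Lemma zero_module_injective M : zero_module M -> injective_module M.
Proof. by move=> M0 U V g f _; exists (zero_map V M) => x; rewrite [LHS]M0 [RHS]M0. Qed.

Lemma zero_module_projective M : zero_module M -> projective M.
Proof.
move=> M0 U V g f _; exists (zero_map M U) => x.
by rewrite (M0 x) !linear0.
Qed.

Lemma injective_retract M N (q : {linear M -> N}) (s : {linear N -> M}) :
  (forall x, q (s x) = x) -> injective_module M -> injective_module N.
Proof.
move=> qs injM U V g f gI; have [h hE] := injM U V g (s \o f) gI.
by exists (q \o h) => x; rewrite /= hE /= qs.
Qed.

Lemma projective_retract M N (q : {linear M -> N}) (s : {linear N -> M}) :
  (forall x, q (s x) = x) -> projective M -> projective N.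
Proof.
move=> qs prM U V g f gS; have [h hE] := prM U V g (f \o q) gS.
by exists (h \o s) => x; rewrite /= hE /= qs.
Qed.

Lemma inj_coresolution_exists k M : inj_dim_le k M ->
  exists I : inj_coresolution M, forall i, (k < i)%N -> zero_module (ic_obj I i).
Proof.
elim: k M => [|k IHk] M /=.
  have [Z Z0] := zero_module_exists => injM.
  pose obj n := if n is n'.+1 then Z else M.
  pose d n : {linear obj n -> obj n.+1} := zero_map (obj n) Z.
  unshelve eexists (@InjCoresolution A M obj d idfun _ _ _ _).
  - by case=> [//|n]; exact: zero_module_injective.
  - by [].
  - by move=> x; split=> // _; exists x.
  - by move=> n x; split=> // _; exists 0; rewrite linear0 (Z0 x).
  - by case.
move=> [I [C [i [p [injI [iI pS pK] /IHk[J J0]]]]]].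
pose obj n := if n is n'.+1 then ic_obj J n' else I.
pose d n : {linear obj n -> obj n.+1} :=
  match n with 0%N => ic_aug J \o p | n'.+1 => ic_d J n' end.
unshelve eexists (@InjCoresolution A M obj d i _ iI _ _).
- by case=> [//|n]; exact: ic_injective.
- move=> x; split=> [/= px|/pK /= ->]; last exact: linear0.
  by apply/pK/(ic_aug_inj (i := J)); rewrite px linear0.
- case=> [|n] x; last exact: ic_exactS.
  split=> [/ic_exact0[c <-]|[y <-]]; last by apply/ic_exact0; exists (p y).
  by have [y <-] := pS c; exists y.
- by case.
Qed.

Lemma inj_dim_of_coresolution k M (I : inj_coresolution M) :
  (forall i, (k < i)%N -> zero_module (ic_obj I i)) -> inj_dim_le k M.
Proof.
elim: k M I => [|k IHk] M I I0 /=.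
  have [w|q qE] := factor_inj (f := idfun : {linear ic_obj I 0 -> ic_obj I 0})
    (ic_aug_inj (i := I)).
    by apply/ic_exact0; apply: I0.
  apply: (@injective_retract _ _ q (ic_aug I)); last exact: ic_injective.
  by move=> x; apply: (ic_aug_inj (i := I)); rewrite qE.
(* The first cosyzygy, the image of the differential at 0, is represented as the kernel of the next
   one; the tail of [I] coresolves it. *)
have [|v vE] := @linear_exists A (ker (ic_d I 1)) (ic_obj I 1) val; first by [].
have vI : injective v by move=> x y; rewrite !vE => /val_inj.
have kerE x : ic_d I 1 x = 0 <-> exists u, v u = x.
  split=> [/eqP dx|[u <-]]; last by rewrite vE; apply/eqP/(valP u).
  by exists (Ker (dx : x \in kerp _)); rewrite vE.
have [w|p pE] := factor_inj (f := ic_d I 0) vI.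
  by apply/kerE/ic_exactS; exists w.
pose J := @InjCoresolution A (ker (ic_d I 1)) (fun n => ic_obj I n.+1)
  (fun n => ic_d I n.+1) v (fun n => @ic_injective A M I n.+1) vI kerE
  (fun n => @ic_exactS A M I n.+1).
exists (ic_obj I 0), (ker (ic_d I 1)), (ic_aug I), p; split.
- exact: ic_injective.
- split; first exact: ic_aug_inj.
    move=> y; have [|x xE] := (@ic_exactS A M I 0 (v y)).1; first by apply/kerE; exists y.
    by exists x; apply: (vI _ _ _); rewrite pE.
  move=> x; rewrite -ic_exact0 -pE; split=> [->|]; first exact: linear0.
  by rewrite -(linear0 v) => e; exact: (vI _ _ e).
- by apply: (IHk _ J) => n kn; exact: I0.
Qed.

Lemma inj_dimE M : inj_dim M = einf (fun k => inj_dim_le k M).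
Proof.
apply: eq_einf => k; split; last exact: inj_coresolution_exists.
by move=> [I]; exact: inj_dim_of_coresolution.
Qed.

Fixpoint proj_dim_le k M : Prop :=
  if k is k'.+1 then
    exists (K P : lmodType A) (i : {linear K -> P}) (p : {linear P -> M}),
      [/\ projective P, short_exact i p & proj_dim_le k' K]
  else projective M.

Lemma proj_resolution_exists k M : proj_dim_le k M ->
  exists P : proj_resolution M, forall i, (k < i)%N -> zero_module (pr_obj P i).
Proof.
elim: k M => [|k IHk] M /=.
  have [Z Z0] := zero_module_exists => prM.
  pose obj n := if n is n'.+1 then Z else M.
  pose d n : {linear obj n.+1 -> obj n} := zero_map Z (obj n).
  unshelve eexists (@ProjResolution A M obj d idfun _ _ _ _).
  - by case=> [//|n]; exact: zero_module_projective.
  - by move=> x; exists x.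
  - by move=> x; split=> [/= ->|[y <-] //]; exists 0.
  - by move=> n x; split=> // _; exists 0; rewrite linear0 (Z0 x).
  - by case.
move=> [K [P [i [p [prP [iI pS pK] /IHk[Q Q0]]]]]].
pose obj n := if n is n'.+1 then pr_obj Q n' else P.
pose d n : {linear obj n.+1 -> obj n} :=
  match n with 0%N => i \o pr_aug Q | n'.+1 => pr_d Q n' end.
unshelve eexists (@ProjResolution A M obj d p _ pS _ _).
- by case=> [//|n]; exact: pr_projective.
- move=> x; rewrite pK; split=> [[u <-]|[y <-]]; last by exists (pr_aug Q y).
  by have [y <-] := pr_aug_surj Q u; exists y.
- case=> [|n] x; last exact: pr_exactS.
  rewrite -[X in _ <-> X]pr_exact0; split=> [/= ix|/= ->]; last exact: linear0.
  by apply: iI; rewrite ix linear0.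
- by case.
Qed.

End Dimensions.

(** * Direct sums, free resolutions and global dimension *)

Section DirectSum.
Variables (A : pzRingType) (S : choiceType).
Implicit Types M N P : lmodType A.

Definition finsupp M : set (S -> M) :=
  [set f | exists l : seq S, forall s, s \notin l -> f s = 0].

Lemma submodule_finsupp M : submodule (@finsupp M).
Proof.
split; first by exists [::].
move=> a f g [k k0] [l l0]; exists (k ++ l) => s.
by rewrite mem_cat negb_or => /andP[/k0 fs /l0 gs]; rewrite !fctE fs gs scaler0 addr0.
Qed.

(** The direct sum of copies of [M] indexed by [S]; presenting it as a kernel lets it inherit the
    module structure of [ker]. *)
Definition dsum M : lmodType A := ker (quotient_map (@submodule_finsupp M)).

Lemma dsumP M (x : dsum M) : exists l : seq S, uniq l /\ forall s, s \notin l -> val x s = 0.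
Proof.
have /eqP := valP x; rewrite -(linear0 (quotient_map _)) => /quotient_mapP[l l0].
exists (undup l); rewrite undup_uniq; split=> // s; rewrite mem_undup => /l0.
by rewrite subr0.
Qed.

Lemma dsum_exists M (f : S -> M) (l : seq S) :
  (forall s, s \notin l -> f s = 0) -> exists x : dsum M, val x = f.
Proof.
move=> l0; have kf : f \in kerp (quotient_map (@submodule_finsupp M)).
  apply/eqP; rewrite -(linear0 (quotient_map _)); apply/quotient_mapP.
  by exists l => s /l0; rewrite subr0.
by exists (Ker kf).
Qed.

Lemma dsum_map M N (k : {linear M -> N}) :
  exists h : {linear dsum M -> dsum N}, forall x s, val (h x) s = k (val x s).
Proof.
have ex (x : dsum M) : exists y : dsum N, val y = fun s => k (val x s).
  have [l [_ l0]] := dsumP x; apply: (@dsum_exists _ _ l) => s /l0 ->.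
  exact: linear0.
have [h hE] := choice ex; have [|h' h'E] := @linear_exists A _ _ h.
  move=> a x y; apply/val_inj/funext => s.
  by rewrite hE /= !fctE !hE linearP.
by exists h' => x s; rewrite h'E hE.
Qed.

Lemma dsum_short_exact M N P (i : {linear M -> N}) (p : {linear N -> P}) :
    short_exact i p ->
  exists (di : {linear dsum M -> dsum N}) (dp : {linear dsum N -> dsum P}),
    short_exact di dp.
Proof.
move=> [iI pS pK]; have [di diE] := dsum_map i; have [dp dpE] := dsum_map p.
exists di, dp; split=> [x y dixy|z|y].
- by apply/val_inj/funext => s; apply: iI; rewrite -!diE dixy.
- have [l [_ l0]] := dsumP z.
  (* Taking 0 as preimage outside the support keeps the chosen family finitely supported. *)
  have ex s : exists y, p y = val z s /\ (s \notin l -> y = 0).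
    have [sl|/l0 ->] := boolP (s \in l); last by exists 0; rewrite linear0.
    by have [y yE] := pS (val z s); exists y.
  have [f fE] := choice ex.
  have [|y yE] := @dsum_exists _ f l; first by move=> s; apply: (fE s).2.
  by exists y; apply/val_inj/funext => s; rewrite dpE yE; apply: (fE s).1.
split=> [dy0|[x <-]]; last first.
  by apply/val_inj/funext => s; rewrite dpE diE; apply/pK; exists (val x s).
have [l [_ l0]] := dsumP y.
have ex s : exists u, i u = val y s.
  by apply/pK; rewrite -dpE dy0.
have [f fE] := choice ex.
have [s sl|x xE] := @dsum_exists _ f l.
  by apply: iI; rewrite fE l0 // linear0.
by exists x; apply/val_inj/funext => s; rewrite diE xE.
Qed.

Section Free.
Variables (M : lmodType A) (phi : S -> M).

Let comb (x : dsum A^o) : M := \sum_(s \in [set: S]) (val x s : A) *: phi s.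

Let combE (x : dsum A^o) (l : seq S) :
  uniq l -> (forall s, s \notin l -> val x s = 0) ->
  comb x = \sum_(s <- l) (val x s : A) *: phi s.
Proof.
move=> ul l0; rewrite /comb (fsbigE l) //; first by under eq_bigl do rewrite in_setT.
by move=> s _ /l0 ->; rewrite scale0r.
Qed.

(** Allowing any list that contains the support lets two elements be expanded over a common list. *)
Lemma free_lift : exists h : {linear dsum A^o -> M},
  forall x l, uniq l -> (forall s, s \notin l -> val x s = 0) ->
    h x = \sum_(s <- l) (val x s : A) *: phi s.
Proof.
have [|h hE] := @linear_exists A _ _ comb; last first.
  by exists h => x l ul l0; rewrite hE (combE ul l0).
move=> a x y; have [k [_ k0]] := dsumP x; have [l [_ l0]] := dsumP y.
pose m := undup (k ++ l).
have xm s : s \notin m -> val x s = 0.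
  by rewrite mem_undup mem_cat negb_or => /andP[/k0].
have ym s : s \notin m -> val y s = 0.
  by rewrite mem_undup mem_cat negb_or => /andP[_ /l0].
rewrite !(@combE _ m) ?undup_uniq //; last first.
  by move=> s sm; rewrite /= !fctE xm // ym // scaler0 addr0.
rewrite scaler_sumr -big_split; apply: eq_bigr => s _.
by rewrite /= !fctE scalerDl scalerA.
Qed.

End Free.

Lemma free_basis : exists e : S -> dsum A^o, forall x : dsum A^o,
  forall l, uniq l -> (forall s, s \notin l -> val x s = 0) ->
    x = \sum_(s <- l) (val x s : A) *: e s.
Proof.
have ex (t : S) : exists y : dsum A^o, val y = fun s => if s == t then 1 else 0.
  by apply: (@dsum_exists _ _ [:: t]) => s; rewrite inE => /negbTE ->.
have [e eE] := choice ex; exists e => x l ul l0; apply/val_inj/funext => t.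
rewrite (linear_sum (val : {linear dsum A^o -> _})) fct_sumE.
have [tl|tl] := boolP (t \in l).
  rewrite (bigD1_seq t) //= fctE eE eqxx big1_seq ?addr0; first exact/esym/mulr1.
  by move=> s /andP[st _]; rewrite fctE eE eq_sym (negbTE st) scaler0.
rewrite l0 // big1_seq // => s /= sl; rewrite fctE eE.
by case: eqP sl => [<-|_ _]; rewrite ?(negbTE tl) // scaler0.
Qed.

Lemma free_projective : projective (dsum A^o).
Proof.
move=> U V g f gS; have [e eE] := free_basis.
have [u uE] := choice (fun s => gS (f (e s))).
have [h hE] := free_lift u; exists h => x; have [l [ul l0]] := dsumP x.
rewrite (hE x l) // {2}(eE x l) // !linear_sum; apply: eq_bigr => s _.
by rewrite !linearZ uE.
Qed.

End DirectSum.

(** * Free covers, and global dimension through injective dimension *)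

Section Covers.
Variable A : pzRingType.

Lemma free_cover_exists (M : lmodType A) :
  exists q : {linear dsum M A^o -> M}, surjective_fun q.
Proof.
have [q qE] := @free_lift A M M id; exists q => m.
have [|x xE] := @dsum_exists A M A^o (fun s => if s == m then 1 else 0) [:: m].
  by move=> s; rewrite inE => /negbTE ->.
exists x; rewrite (qE x [:: m]) //; last by move=> s; rewrite inE xE => /negbTE ->.
by rewrite big_seq1 xE eqxx scale1r.
Qed.

Definition free_cover (M : lmodType A) : {linear dsum M A^o -> M} :=
  projT1 (cid (free_cover_exists M)).

Lemma free_cover_surj (M : lmodType A) : surjective_fun (free_cover M).
Proof. exact: (projT2 (cid (free_cover_exists M))). Qed.

Lemma projective_summand (P : lmodType A) : projective P ->
  exists s : {linear P -> dsum P A^o}, forall x, free_cover P (s x) = x.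
Proof.
by move=> /(_ _ _ (free_cover P) idfun (@free_cover_surj P))[s sE]; exists s.
Qed.

Definition iter_kernel (M : lmodType A) (n : nat) : lmodType A :=
  iter n (fun N => ker (free_cover N)) M.

Lemma free_cover_exact (M : lmodType A) (x : dsum M A^o) :
  free_cover M x = 0 <->
  exists y, (val \o free_cover (ker (free_cover M))) y = x.
Proof.
split=> [/eqP kx|[y <-]]; last exact/eqP/(valP (free_cover _ y)).
by have [y yE] := free_cover_surj (Ker (kx : x \in kerp _)); exists y; rewrite /= yE.
Qed.

(** Transparent, because its terms and differentials must compute to the free covers of the iterated
    kernels. *)
Definition free_resolution (M : lmodType A) : proj_resolution M.
Proof.
refine (@ProjResolution A M (fun n => dsum (iter_kernel M n) A^o)
  (fun n => val \o free_cover (iter_kernel M n.+1)) (free_cover M) _ _ _ _).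
- by move=> n; exact: free_projective.
- exact: free_cover_surj.
- exact: free_cover_exact.
- move=> n x; rewrite -free_cover_exact /=.
  by split=> [vx|->//]; apply: val_inj.
Defined.

Lemma iter_kernel_proj_dim (M : lmodType A) k n :
  projective (iter_kernel M (k + n)) -> proj_dim_le k (iter_kernel M n).
Proof.
elim: k n => [//|k IHk] n prM /=; set N := iter_kernel M n.
exists (ker (free_cover N)), (dsum N A^o), val, (free_cover N).
split; [exact: free_projective| |].
  split; [exact: val_inj|exact: free_cover_surj|move=> x].
  split=> [/eqP kx|[u <-]]; last exact/eqP/(valP u).
  by exists (Ker (kx : x \in kerp _)).
by apply: (IHk n.+1); rewrite addnS.
Qed.

Lemma proj_dim_of_ext k (M : lmodType A) :
  (forall X, ext_zero (free_resolution M) k X) -> proj_dim_le k M.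
Proof.
move=> EM; apply: (@iter_kernel_proj_dim M k 0); rewrite addn0.
set N := iter_kernel M k.
(* The cocycle is the cover of K = ker (free_cover N) by the next term; bounding it yields a
   retraction g of the free cover of N onto K, so N is a direct summand. *)
have [y|g gE] := EM (ker (free_cover N)) (free_cover (ker (free_cover N))).
  by apply/eqP; apply: (valP (free_cover _ y)).
have gv u : g (val u) = u.
  by have [y <-] := free_cover_surj u; rewrite -[LHS]gE.
have [x|s sE] := @factor_surj A _ N _ (free_cover N) (idfun \- (val \o g))
    (@free_cover_surj N).
  by move=> /eqP kx; rewrite /= -[x]/(val (Ker (kx : x \in kerp _))) gv subrr.
apply: (@projective_retract A _ _ (free_cover N) s); last exact: free_projective.
move=> u; have [x <-] := free_cover_surj u; rewrite sE /= linearB.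
by have /eqP -> := valP (g x); rewrite subr0.
Qed.

Lemma einf_leP (P : nat -> Prop) k :
  ele (einf P) (Some k) <-> exists2 n, (n <= k)%N & P n.
Proof.
rewrite /einf; case: pselect => /= [exP|nP].
  case: ex_minnP => m /asboolP Pm minm; split=> [mk|[n nk Pn]]; first by exists m.
  by apply: leq_trans nk; apply/minm/asboolP.
by split=> // -[n _ Pn]; apply: nP; exists n; apply/asboolP.
Qed.

(** A uniform bound k on projective dimensions and one on injective dimensions both amount to the
    vanishing of Ext^(k+1) on all pairs of modules. *)
Lemma gl_dimE : gl_dim A = einf (fun k => forall X : lmodType A, inj_dim_le k X).
Proof.
apply: eq_einf => k; split=> [pdA M0|idA M]; last first.
  apply/einf_leP; exists k => //; apply/proj_resolution_exists/proj_dim_of_ext => X.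
  exact: (ext_zero_inj_dim (idA X)).
have ex (X : lmodType A) : exists P : proj_resolution X,
    forall i, (k < i)%N -> zero_module (pr_obj P i).
  have /einf_leP[n nk [P P0]] := pdA X; exists P => i ki.
  by apply: P0; exact: leq_ltn_trans ki.
apply: (@inj_dim_of_ext A _ id (fun X => projT1 (cid (ex X)))) => [M EM|X].
  by apply: injective_of_ext => X; exists (projT1 (cid (ex X))).
case: cid => P P0 /= f _; exists (zero_map _ _) => x.
by rewrite (P0 k.+1 (ltnSn k) x) !linear0.
Qed.

End Covers.

Section ArtinianDirectSums.
Variable A : pzRingType.
Hypothesis dccA : dcc A.
Variables (A0 : lmodType A) (p : {linear A^o -> A0}).
Hypothesis p_ker : forall a, p a = 0 <-> in_jacobson_radical a.

(* As the radical J is finitely generated, a map from J to a direct sum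
   has finitely many nonzero components. *)
Lemma dsum_injective (S : choiceType) (I : lmodType A) :
  injective_module I -> injective_module (dsum S I).
Proof.
move=> injI; apply: (artin_baer dccA p_ker) => f.
(* Choosing m = 0 wherever the component of f vanishes makes the family of the m finitely
   supported. *)
have ex s : exists m : I, (forall j, val (f j) s = (val j : A) *: m) /\
    ((forall j, val (f j) s = 0) -> m = 0).
  have [fs0|fsN0] := pselect (forall j, val (f j) s = 0).
    by exists 0; split=> // j; rewrite fs0 scaler0.
  have [|fs fsE] := @linear_exists A _ I (fun j => val (f j) s).
    by move=> a x y; rewrite linearP.
  have [h hE] := injI _ _ (val : {linear ker p -> A^o}) fs val_inj.
  exists (h 1); split=> // j; rewrite -linearZ -fsE -hE; congr (h _).
  exact/esym/mulr1.
have [m mE] := choice ex.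
have [l lE] := jacobson_finitely_generated dccA.
have [L L0] : exists L : seq S, forall s, s \notin L ->
    forall j : ker p, val j \in l -> val (f j) s = 0.
  elim: l {lE} => [|a l [L L0]]; first by exists [::].
  have [ka|ka] := boolP (a \in kerp p); last first.
    exists L => s sL j; rewrite inE => /orP[/eqP ja|]; last exact: L0.
    by case/negP: ka; rewrite -ja; exact: valP.
  have [k [_ k0]] := dsumP (f (Ker ka)).
  exists (k ++ L) => s; rewrite mem_cat negb_or => /andP[sk sL] j.
  rewrite inE => /orP[/eqP ja|]; last exact: L0.
  by rewrite (_ : j = Ker ka) ?k0 //; apply: val_inj.
have [s sL|x xE] := @dsum_exists A S I m L.
  apply: (mE s).2 => j.
  have /p_ker/lE Jj : p (val j) = 0 by apply/eqP/(valP j).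
  have [|x xl|j' [jj' fj']] := Jj [set a | exists j, val j = a /\ val (f j) s = 0].
  - split; first by exists 0; rewrite !linear0.
    by move=> a _ _ [j1 [<- f1]] [j2 [<- f2]]; exists (a *: j1 + j2);
      rewrite !linearP /= !fctE f1 f2 scaler0 addr0.
  - have /p_ker/eqP kx : in_jacobson_radical x by apply/lE => T sT; apply.
    by exists (Ker (kx : x \in kerp p)); split=> //; apply: (L0 s sL).
  - by rewrite -fj'; congr (val (f _) s); apply: val_inj.
by exists x => j; apply/val_inj/funext => s; rewrite (mE s).1 /= fctE xE.
Qed.

Lemma dsum_inj_dim (S : choiceType) k (M : lmodType A) :
  inj_dim_le k M -> inj_dim_le k (dsum S M).
Proof.
elim: k M => [|k IHk] M /=; first exact: dsum_injective.
move=> [I [C [i [q [injI ses /IHk dimC]]]]].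
have [di [dq dses]] := dsum_short_exact S ses.
by exists (dsum S I), (dsum S C), di, dq; split=> //; exact: dsum_injective.
Qed.

Lemma ext_zero_projective k X (R : proj_resolution X) (Q : lmodType A) j :
    inj_dim_le k A^o -> projective Q -> (k <= j)%N -> ext_zero R j Q.
Proof.
move=> idA prQ kj; have [s sE] := projective_summand prQ.
apply: (ext_zero_retract sE); apply: ext_zero_inj_dim kj.
exact: dsum_inj_dim.
Qed.

End ArtinianDirectSums.

(** * Syzygies in a minimal resolution *)

Section SimpleQuotients.
Variable A : pzRingType.

(** If f x were nonzero, x would generate U modulo ker f; then ker g + ker f = U, and superfluity
    would give f = 0. *)
Lemma superfluous_ker_simple (U V T : lmodType A) (g : {linear U -> V})
    (f : {linear U -> T}) :
  superfluous_ker g -> simple_module T -> forall x, g x = 0 -> f x = 0.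
Proof.
move=> supg [_ genT] x gx0; apply: contrapT => fx0.
have /asboolP // : x \in [pred u | `[< f u = 0 >]].
apply: (supg _ (submodule_pred (submodule_ker f))) => u.
have [a fu] := genT _ (f u) fx0.
exists (a *: x); first by rewrite linearZ /= gx0 scaler0.
by apply/asboolP; rewrite /= linearB linearZ /= -fu subrr.
Qed.

Lemma simple_quotient (V : lmodType A) : dcc A -> ~ zero_module V ->
  exists (T : lmodType A) (f : {linear V -> T}), simple_module T /\ surjective_fun f.
Proof.
move=> dccA V0.
(* [N0] is J V, a proper submodule by Nakayama's lemma, so V/JV is nonzero and killed by J. *)
pose N0 : set V := [set v | forall T : set V, submodule T ->
  (forall (j : A) q, in_jacobson_radical j -> T (j *: q)) -> T v].
have sN0 : submodule N0.
  split=> [T sT _|a x y Ix Iy T sT IT]; first exact: submodule0 sT.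
  by apply: sT.2; [apply: Ix | apply: Iy].
have [x N0x] : exists x, ~ N0 x.
  apply: contrapT => /forallNP all; apply: V0 => x.
  apply: (@nakayama A dccA V [set 0] setT) => //; first exact: submodule0set.
  move=> s _ T sT _ JT; have /contrapT := all s; apply=> // j q Jj.
  exact: JT.
have JN0 (j : A) q : in_jacobson_radical j -> setT q -> N0 (j *: q).
  by move=> Jj _ T sT; apply.
have [N [sN _ _ Nx gen]] := max_submodule_over_radical dccA (submoduleT V) sN0
  (@subsetT _ _) JN0 I N0x.
have [T [f [fS fN]]] := quotient_exists sN; exists T, f; split=> //; split.
  by exists (f x) => /fN.
move=> t u; have [y <-] := fS t; have [q <-] := fS u => fy.
have [|a Na] := gen y q I _ I; first by move=> /fN.
exists a; apply/eqP; rewrite -subr_eq0 -linearZ -linearB; exact/eqP/fN.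
Qed.

End SimpleQuotients.

(** * Ext from A/J along its minimal resolution *)

Section MinimalResolution.
Variable A : pzRingType.
Hypothesis dccA : dcc A.
Variables (A0 : lmodType A) (p : {linear A^o -> A0}).
Hypothesis p_surj : surjective_fun p.
Hypothesis p_ker : forall a, p a = 0 <-> in_jacobson_radical a.
Variable P : proj_resolution A0.

Lemma inj_dim_of_ext_top k (M : lmodType A) : ext_zero P k M -> inj_dim_le k M.
Proof.
move=> EM; apply: (@inj_dim_of_ext A unit (fun=> A0) (fun=> P)) => // N /(_ tt) EN.
apply: (artin_baer dccA p_ker) => f.
have [h hE] := extend_of_ext f p_surj EN.
exists (h 1) => j; rewrite -linearZ -hE; congr (h _).
exact/esym/mulr1.
Qed.

(** Treats the three cases of [syzygy] uniformly. The clause on the kernel of q says that cocycles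
    on the n-th term are the maps that factor through the syzygy. *)
Lemma syzygy_cover n :
  exists (i : {linear syzygy P n.+1 -> pr_obj P n})
         (q : {linear pr_obj P n -> syzygy P n}),
    short_exact i q /\ forall x, q x = 0 <-> exists y, pr_d P n y = x.
Proof.
have kerE (U V : lmodType A) (f : {linear U -> V}) x :
    f x = 0 <-> exists u : ker f, val u = x.
  split=> [/eqP kx|[u <-]]; last exact/eqP/(valP u).
  by exists (Ker (kx : x \in kerp _)).
have corestrict (U V W : lmodType A) (d : {linear U -> V}) (f : {linear V -> W}) :
    (forall x, f x = 0 <-> exists u, d u = x) ->
    exists2 q : {linear U -> ker f}, surjective_fun q & forall x, q x = 0 <-> d x = 0.
  move=> fd; have [w|q qE] := @factor_inj A (ker f) V U val d val_inj.
    by apply/kerE/fd; exists w.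
  exists q => [y|x]; last by rewrite -qE; split=> [->|dx]; [|apply: val_inj].
  have [|u uE] := (fd (val y)).1; first by apply/kerE; exists y.
  by exists u; apply: val_inj; rewrite qE.
case: n => [|[|n]] /=.
- exists val, (pr_aug P); split; last exact: pr_exact0.
  by split; [exact: val_inj|exact: pr_aug_surj|exact: kerE].
- have [q qS qK] := corestrict _ _ _ _ _ (pr_exact0 (p := P)).
  exists val, q; split=> [|x]; last by rewrite qK pr_exactS.
  by split=> // x; rewrite qK; exact: kerE.
- have [q qS qK] := corestrict _ _ _ _ _ (@pr_exactS _ _ P n).
  exists val, q; split=> [|x]; last by rewrite qK pr_exactS.
  by split=> // x; rewrite qK; exact: kerE.
Qed.

Hypothesis minP : minimal_pr P.

(** By minimality, maps to a simple module vanish on images of differentials: every f is a cocycle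
    and every coboundary is 0. A nonzero term would have a simple quotient, giving a nonzero
    class. *)
Lemma ext_simple_zero k :
    (forall T : lmodType A, simple_module T -> ext_zero P k T) ->
  zero_module (pr_obj P k.+1).
Proof.
move=> ET; apply: contrapT => /(simple_quotient dccA)[T [f [simT fS]]].
have [y|g gE] := ET T simT f.
  by apply: (superfluous_ker_simple _ (minP.2 k) simT); exact: pr_dd.
have [[t t0] _] := simT; have [x fx] := fS t; apply: t0; rewrite -fx gE.
move: (x) g {gE}; case: (k) => [|l] y g.
  apply: (superfluous_ker_simple _ minP.1 simT).
  by apply/pr_exact0; exists y.
by apply: (superfluous_ker_simple _ (minP.2 l) simT); exact: pr_dd.
Qed.

Lemma inj_dim_of_ext_simple k :
    (forall T : lmodType A, simple_module T -> ext_zero P k T) ->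
  forall X : lmodType A, inj_dim_le k X.
Proof.
move=> /ext_simple_zero P0 X; apply: inj_dim_of_ext_top => f _.
by exists (zero_map _ _) => x; rewrite (P0 x) !linear0.
Qed.

(* Dimension shifting down along the projectives P_j, which have finite
   injective dimension because A has. *)
Lemma ext_syzygy_top m n k : inj_dim_le m A^o ->
    (forall j, (k <= j)%N -> ext_zero P j (syzygy P n)) ->
  exists N, forall j, (N <= j)%N -> ext_zero P j A0.
Proof.
move=> idA; elim: n k => [|n IHn] k Ek; first by exists k.
have [i [q [ses _]]] := syzygy_cover n.
apply: (IHn (maxn m k)) => j; rewrite geq_max => /andP[mj kj].
apply: (ext_zero_quotient ses); last by apply: Ek; exact: leqW.
exact: (ext_zero_projective dccA p_ker idA (@pr_projective _ _ P n)).
Qed.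

(* A simple T with Ext^(k+1)(A0, T) <> 0 would be a quotient of the syzygy,
   and Ext^(k+1)(A0, -) is right exact as Ext^(k+2) vanishes. *)
Lemma inj_dim_syzygy_descent n k :
    ~ zero_module (syzygy P n) -> ext_zero P k (syzygy P n) ->
    (forall X : lmodType A, inj_dim_le k.+1 X) ->
  forall X : lmodType A, inj_dim_le k X.
Proof.
move=> syz0 Esyz dimA; apply: inj_dim_of_ext_simple => T simT.
apply: contrapT => ET.
have [pi pi_surj] : exists pi : {linear syzygy P n -> T}, surjective_fun pi.
  case: n syz0 {Esyz} => [|n] syz0.
    have [q [s qs]] := simple_retract dccA p_surj p_ker simT.
    by exists q => t; exists (s t).
  have [i [q [[_ qS _] qK]]] := syzygy_cover n.+1.
  (* If k < n, Ext^(n+1)(A/J, -) vanishes, so the term of index n+1 is zero and with it the syzygy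
     that it covers. *)
  have [kn|nk] := ltnP k n.
    case: syz0 => y; have [x <-] := qS y.
    rewrite (@ext_simple_zero n _ x) ?linear0 // => T' _.
    exact: ext_zero_inj_dim (dimA T') _ kn.
  (* Its vanishing would bound the injective dimension of T by n, at most k, against [ET]. A cocycle
     that is not a coboundary is nonzero and factors through the syzygy. *)
  have : ~ ext_zero P n T.
    by move=> /inj_dim_of_ext_top/ext_zero_inj_dim/(_ _ nk).
  move=> /existsNP[f /not_implyP[fd0 nofactor]].
  have [x|pi piE] := @factor_surj _ _ _ _ q f qS.
    by move=> /qK[y <-].
  have [x fx0] : exists x, f x <> 0.
    apply: contrapT => /forallNP f0; apply: nofactor; exists (zero_map _ _) => x.
    exact: (contrapT (f0 x)).
  exists pi => t; have [_ genT] := simT; have [a ->] := genT _ t fx0.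
  by exists (q (a *: x)); rewrite piE linearZ.
apply: ET.
have ses : short_exact (val : {linear ker pi -> _}) pi.
  split; [exact: val_inj|by []|move=> x].
  split=> [/eqP kx|[u <-]]; last exact/eqP/(valP u).
  by exists (Ker (kx : x \in kerp _)).
apply: (ext_zero_quotient ses) => //.
exact: ext_zero_inj_dim (dimA _) _ (leqnn _).
Qed.

Lemma inj_dim_syzygy m n : inj_dim_le m A^o -> ~ zero_module (syzygy P n) ->
  inj_dim (syzygy P n) = gl_dim A.
Proof.
move=> idA syz0; rewrite inj_dimE gl_dimE; apply: eq_einf => k.
split=> [dim_syz|]; last exact.
have Esyz := ext_zero_inj_dim (P := P) dim_syz.
have [N EN] := ext_syzygy_top idA Esyz.
have : forall X : lmodType A, inj_dim_le (N + k) X.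
  apply: inj_dim_of_ext_simple => T /(simple_retract dccA p_surj p_ker)[q [s qs]].
  by apply: (ext_zero_retract qs); apply: EN; exact: leq_addr.
(* Each descent lowers the uniform bound by one and stops at k, the last index where vanishing for
   the syzygy is known. *)
elim: N {EN} => // N IHN dimA; apply: IHN.
by apply: (inj_dim_syzygy_descent syz0) => //; apply: Esyz; exact: leq_addl.
Qed.

End MinimalResolution.

Theorem theorem4p9 (R : comPzRingType) (A : algType R)
    (artinA : artin_algebra A) (magA : minimal_auslander_gorenstein A)
    (A0 : lmodType A) (A0_def : radical_quotient A0)
    (P : proj_resolution A0) (minP : minimal_pr P) (n : nat) :
  ~ zero_module (syzygy P n) -> inj_dim (syzygy P n) = gl_dim A.
Proof.
have [artR fgA] := artinA; have dccA := artin_algebra_dcc artR fgA.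
have [p [p_surj p_ker]] := A0_def; have [[idA _] _] := magA.
have [m dimA] : exists m, inj_dim_le m A^o.
  move: idA; rewrite inj_dimE /einf; case: pselect => // [[m /asboolP dimA] _].
  by exists m.
exact: (inj_dim_syzygy dccA p_surj p_ker minP dimA).
Qed.
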